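(* After inverting $2$ (that is, over $\mathbb Z_\epsilon[\tfrac12]$), there are only two formal ternary laws (FTLs) of degree $\le 0$. One of these laws is the FTL associated with Chow–Witt groups.
   Context: All rings are commutative with unit. $\mathbb Z_\epsilon:=\mathbb Z[\epsilon]/(\epsilon^2-1)$, which is the Grothendieck–Witt ring of $\mathbb Z$. **Multivalued series.** An $(n,d)$-series over a ring $R$ is a polynomial $F_t(\underline x)=1+F_1(\underline x)t+\dots+F_n(\underline x)t^n$ with $F_l\in R[[x_1,\dots,x_d]]$. It is composable if $F_l(\underline 0)=0$ for all $l$. **Substitution.** Let $F_t(x_1,\dots,x_d)$ be an $(n,d)$-series, $G_t(\underline y)$ a composable $(m,r)$-series, and $1\le i\le d$. With auxiliary variables $u_1,\dots,u_m$, the product $\prod_{l=1}^m F_t(x_1,\dots,x_{i-1},u_l,x_{i+1},\dots,x_d)$ is symmetric in the $u_l$, hence is uniquely of the form $\Phi(x_1,\dots,\widehat{x_i},\dots,x_d,e_1(\underline u),\dots,e_m(\underline u))$, where $e_l$ is the $l$-th elementary symmetric polynomial and $\Phi$ is a polynomial in $t$ whose coefficients are power series. The substitution $F_t(x_1,\dots,x_{i-1},G_t(\underline y),x_{i+1},\dots,x_d)$ is the $(nm,d+r-1)$-series obtained from $\Phi$ by replacing $e_l(\underline u)$ with $G_l(\underline y)$ for $l=1,\dots,m$. **Formal ternary laws.** Let $R$ be a $\mathbb Z_\epsilon$-algebra. A formal ternary law (FTL) over $R$ is a $(4,3)$-series $F_t(x,y,z)=1+\sum_{l=1}^4F_l(x,y,z)t^l$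 over $R$ such that: 1. (Neutral element) $F_t(x,0,0)=(1+xt)^2(1-\epsilon xt)^2$; 2. (Symmetry) $F_t(x,y,z)$ is invariant under permutations of $x,y,z$; 3. (Associativity) $F_t(F_t(x,y,z),u,v)=F_t(x,F_t(y,z,u),v)$ as $(16,5)$-series, in the sense of substitution; 4. ($\epsilon$-linearity) $F_t(-\epsilon x,y,z)=F_{-\epsilon t}(x,y,z)$; 5. (Weak neutral element) $F_4(x,x,0)=0$. **Degree.** Write $F_t(x,y,z)=1+\sum_{i,j,k\ge0,\,1\le l\le4}a^l_{ijk}x^iy^jz^kt^l$. The degree of $F_t$ is the supremum of the integers $i+j+k-l$ over all $(i,j,k,l)$ with $a^l_{ijk}\ne0$; thus degree $\le 0$ means that $a^l_{ijk}=0$ whenever $i+j+k>l$. **The FTL associated with Chow–Witt groups** (and with Milnor–Witt motivic cohomology) is, by an earlier computation, the following law, where $\sigma(m)$ denotes the sum of all distinct monomials obtained from $m$ by permuting $x,y,z$: $F_1=2(1-\epsilon)\sigma(x)$; $F_2=2(1-2\epsilon)\sigma(x^2)+2(1-\epsilon)\sigma(xy)$; $F_3=2(1-\epsilon)\sigma(x^3)-2(1-\epsilon)\sigma(x^2y)+8(2-3\epsilon)xyz$; $F_4=\sigma(x^4)-2(1-\epsilon)\sigma(x^3y)+2(1-2\epsilon)\sigma(x^2y^2)+2(1-\epsilon)\sigma(x^2yz)$. *)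

(* Defs.v *)
From HB Require Import structures.
From mathcomp Require Import all_boot all_order all_fingroup all_algebra.
From mathcomp Require boolp.
From mathcomp Require Import mpoly.

Set Implicit Arguments.
Unset Strict Implicit.
Unset Printing Implicit Defensive.

Import Order.TTheory GRing.Theory Num.Theory.
Import Pdiv.RingMonic Pdiv.CommonRing.
Local Open Scope ring_scope.

(* The power series ring R[[x_1, ..., x_d]]: a series is its family of
   coefficients.  The decidable equality and the choice operator are the
   classical ones. *)
Definition mps (R : comNzRingType) (d : nat) : Type := 'X_{1..d} -> R.

HB.instance Definition _ R d := boolp.gen_eqMixin (mps R d).
HB.instance Definition _ R d := boolp.gen_choiceMixin (mps R d).

Section PowerSeriesRing.
Context {R : comNzRingType} {d : nat}.
Implicit Types f g h : mps R d.

Definition mps_zero : mps R d := fun=> 0.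
Definition mps_one : mps R d := fun m => (m == 0%MM)%:R.
Definition mps_opp f : mps R d := fun m => - f m.
Definition mps_add f g : mps R d := fun m => f m + g m.
Definition mps_scale (a : R) f : mps R d := fun m => a * f m.
Definition mps_mul f g : mps R d := fun m =>
  \sum_(k : 'X_{1..d < (mdeg m).+1, (mdeg m).+1} | m == (k.1 + k.2)%MM)
     f k.1 * g k.2.

Lemma mpsP f g : f =1 g -> f = g.
Proof. exact: boolp.funext. Qed.

Lemma mps_addA : associative mps_add.
Proof. by move=> f g h; apply: mpsP => m; apply: addrA. Qed.
Lemma mps_addC : commutative mps_add.
Proof. by move=> f g; apply: mpsP => m; apply: addrC. Qed.
Lemma mps_add0 : left_id mps_zero mps_add.
Proof. by move=> f; apply: mpsP => m; apply: add0r. Qed.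
Lemma mps_addN : left_inverse mps_zero mps_opp mps_add.
Proof. by move=> f; apply: mpsP => m; apply: addNr. Qed.

HB.instance Definition _ :=
  GRing.isZmodule.Build (mps R d) mps_addA mps_addC mps_add0 mps_addN.

Definition mps_trunc (n : nat) f : {mpoly R[d]} :=
  \sum_(m : 'X_{1..d < n}) f m *: 'X_[m].

Lemma mcoeff_trunc n f m : (mdeg m < n)%N -> (mps_trunc n f)@_m = f m.
Proof. exact: mcoeff_mpoly. Qed.

Lemma mps_mulE n f g m : (mdeg m < n)%N ->
  mps_mul f g m = (mps_trunc n f * mps_trunc n g)@_m.
Proof.
move=> lt_mn; rewrite mcoeffM; apply: eq_bigr => -[k1 k2] /= _.
by rewrite !mcoeff_trunc //; apply: leq_trans lt_mn; apply: bmdeg.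
Qed.

Lemma eq_mcoeffM (p p' q q' : {mpoly R[d]}) m :
    (forall k, (mdeg k <= mdeg m)%N -> p@_k = p'@_k) ->
    (forall k, (mdeg k <= mdeg m)%N -> q@_k = q'@_k) ->
  (p * q)@_m = (p' * q')@_m.
Proof.
move=> epp' eqq'; rewrite !mcoeffM; apply: eq_bigr => -[k1 k2] /= _.
by rewrite epp' ?eqq' // -ltnS bmdeg.
Qed.

Lemma mcoeff_trunc_mul n f g m : (mdeg m < n)%N ->
  (mps_trunc n (mps_mul f g))@_m = (mps_trunc n f * mps_trunc n g)@_m.
Proof. by move=> lt_mn; rewrite mcoeff_trunc // (mps_mulE _ _ lt_mn). Qed.

Lemma mps_mulA : associative mps_mul.
Proof.
move=> f g h; apply: mpsP => m; rewrite !(mps_mulE _ _ (ltnSn (mdeg m))).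
set T := mps_trunc _.
transitivity (T f * (T g * T h))@_m.
  by apply: eq_mcoeffM => // k le_km; rewrite mcoeff_trunc_mul.
by rewrite mulrA; apply: eq_mcoeffM => // k le_km; rewrite mcoeff_trunc_mul.
Qed.

Lemma mps_mulC : commutative mps_mul.
Proof.
by move=> f g; apply: mpsP => m; rewrite !(mps_mulE _ _ (ltnSn _)) mulrC.
Qed.

Lemma mps_mul1 : left_id mps_one mps_mul.
Proof.
move=> f; apply: mpsP => m; rewrite (mps_mulE _ _ (ltnSn _)).
rewrite -[RHS](mcoeff_trunc f (ltnSn _)) -[RHS](congr1 (mcoeff m) (mul1r _)).
by apply: eq_mcoeffM => // k le_km; rewrite mcoeff_trunc // mcoeff1.
Qed.

Lemma mps_mulD : left_distributive mps_mul mps_add.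
Proof.
move=> f g h; apply: mpsP => m; rewrite /mps_mul /mps_add -big_split /=.
by apply: eq_bigr => k _; rewrite mulrDl.
Qed.

Lemma mps_one_neq0 : mps_one != 0.
Proof.
by apply/eqP => /(congr1 (@^~ 0%MM)) /eqP; rewrite /mps_one eqxx oner_eq0.
Qed.

HB.instance Definition _ := GRing.Zmodule_isComNzRing.Build (mps R d)
  mps_mulA mps_mulC mps_mul1 mps_mulD mps_one_neq0.

Lemma mps_scaleA a b f : mps_scale a (mps_scale b f) = mps_scale (a * b) f.
Proof. by apply: mpsP => m; apply: mulrA. Qed.
Lemma mps_scale1 : left_id 1 mps_scale.
Proof. by move=> f; apply: mpsP => m; apply: mul1r. Qed.
Lemma mps_scaleDr : right_distributive mps_scale +%R.
Proof. by move=> a f g; apply: mpsP => m; apply: mulrDr. Qed.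
Lemma mps_scaleDl f : {morph mps_scale^~ f : a b / a + b}.
Proof. by move=> a b; apply: mpsP => m; apply: mulrDl. Qed.

HB.instance Definition _ := GRing.Zmodule_isLmodule.Build R (mps R d)
  mps_scaleA mps_scale1 mps_scaleDr mps_scaleDl.

Lemma mps_scaleAl (a : R) (f g : mps R d) : a *: (f * g) = (a *: f) * g.
Proof.
apply: mpsP => m; rewrite [LHS]mulr_sumr.
by apply: eq_bigr => k _; rewrite mulrA.
Qed.

HB.instance Definition _ := GRing.Lmodule_isLalgebra.Build R (mps R d)
  mps_scaleAl.
HB.instance Definition _ := GRing.Lalgebra_isComAlgebra.Build R (mps R d).

Definition mps_var (i : 'I_d) : mps R d := fun m => (m == U_(i)%MM)%:R.

End PowerSeriesRing.

Arguments mps_var {R d} i.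

(* f(g_1, ..., g_d).  Meaningful when every g_i has zero constant term: then
   the monomials k of degree > mdeg m do not contribute to the coefficient of
   m, whence the finite sum. *)
Definition mps_subst (R : comNzRingType) (d e : nat)
    (f : mps R d) (g : 'I_d -> mps R e) : mps R e :=
  fun m => \sum_(k : 'X_{1..d < (mdeg m).+1})
             f k * (\prod_(i < d) g i ^+ (k : 'X_{1..d}) i : mps R e) m.

(* Polynomials in t with power series coefficients are elements of
   {poly mps R d}; F`_l is the coefficient F_l of t^l. *)
Definition tsubst (R : comNzRingType) (d e : nat)
    (F : {poly mps R d}) (g : 'I_d -> mps R e) : {poly mps R e} :=
  map_poly (fun f => mps_subst f g) F.

Definition is_series (R : comNzRingType) (n d : nat) (F : {poly mps R d}) :=
  F`_0 = 1 /\ (size F <= n.+1)%N.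

Definition composable (R : comNzRingType) (d : nat) (F : {poly mps R d}) :=
  forall l, (0 < l)%N -> (F`_l : mps R d) 0%MM = 0.

(* Families indexed by a block of a variables, then m variables, then b. *)
Definition blocks (T : Type) (a m b : nat)
    (f : 'I_a -> T) (g : 'I_m -> T) (h : 'I_b -> T) : 'I_(a + (m + b)) -> T :=
  fun k => match split k with
    | inl i => f i
    | inr k' => match split k' with inl j => g j | inr i => h i end
    end.

Section BlockVariables.
Variables (R : comNzRingType) (a m b : nat).

Definition lvar (i : 'I_a) : mps R (a + (m + b)) := mps_var (lshift _ i).
Definition mvar (j : 'I_m) : mps R (a + (m + b)) :=
  mps_var (rshift a (lshift b j)).
Definition rvar (i : 'I_b) : mps R (a + (m + b)) :=
  mps_var (rshift a (rshift m i)).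

End BlockVariables.

Arguments lvar {R a m b} i.
Arguments mvar {R a m b} j.
Arguments rvar {R a m b} i.

Definition elem_sym (S : comNzRingType) (m : nat) (u : 'I_m -> S) (l : nat) : S :=
  \sum_(A : {set 'I_m} | #|A| == l) \prod_(j in A) u j.

(* H_t = F_t(x_1, ..., x_a, G_t(y), x'_1, ..., x'_b), where the variable of F
   with a variables on its left and b on its right is replaced by the
   (m,r)-series G.  Phi is the (unique) series such that
     prod_(l <= m) F_t(x, u_l, x') = Phi(x, e_1(u), ..., e_m(u), x'),
   and the variables of H are x, y, x', in this order. *)
Definition is_substitution (R : comNzRingType) (a b m r : nat)
    (F : {poly mps R (a + (1 + b))}) (G : {poly mps R r})
    (H : {poly mps R (a + (r + b))}) : Prop :=
  [/\ is_series m G, composable G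
    & exists2 Phi : {poly mps R (a + (m + b))},
        \prod_(l < m) tsubst F (blocks lvar (fun=> mvar l) rvar)
          = tsubst Phi (blocks lvar (fun j : 'I_m => elem_sym mvar j.+1) rvar)
      & H = tsubst Phi (blocks lvar
              (fun j : 'I_m => mps_subst (G`_j.+1) (mvar : 'I_r -> _)) rvar)].

(* Z_eps = Z[eps] / (eps^2 - 1) *)
Definition eps_poly : {poly int} := 'X^2 - 1.
Definition Zeps : comNzRingType := {poly %/ eps_poly}.
Definition Zeps_eps : Zeps := 'qX.

Definition eps (R : comAlgType Zeps) : R := Zeps_eps%:A.

(* R is the localization A[1/s]. *)
Definition is_localization_away (A : comNzRingType) (s : A)
    (R : comAlgType A) : Prop :=
  [/\ exists v : R, s%:A * v = 1,
      forall r : R, exists (n : nat) (c : A), s ^+ n *: r = c%:A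
    & forall c : A, c%:A = 0 :> R -> exists n : nat, s ^+ n * c = 0].

Lemma mk_monic_eps : mk_monic eps_poly = eps_poly.
Proof. by rewrite /mk_monic /eps_poly size_XnsubC // monicXnsubC. Qed.

(* eps |-> (1, -1) embeds Z_eps in Q x Q. *)
Definition Zeps_ev (c : Zeps) : rat * rat :=
  let p : {poly int} := \val c in (p.[1]%:~R, p.[-1]%:~R).

Lemma horner_rmodp_eps (p : {poly int}) x : x ^+ 2 = 1 ->
  (rmodp p (mk_monic eps_poly)).[x] = p.[x].
Proof.
rewrite mk_monic_eps => x2.
rewrite [in RHS](rdivp_eq (monicXnsubC 1 (isT : 0 < 2)%N) p).
by rewrite hornerD hornerM !hornerE /= x2 subrr mulr0 add0r.
Qed.

Lemma Zeps_evB : {morph Zeps_ev : c d / c - d}.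
Proof. by move=> c d; rewrite /Zeps_ev /= !hornerE !rmorphB. Qed.
Lemma Zeps_ev1 : Zeps_ev 1 = 1.
Proof. by rewrite /Zeps_ev /= !hornerC. Qed.
Lemma Zeps_evM : {morph Zeps_ev : c d / c * d}.
Proof.
move=> c d; rewrite /Zeps_ev /=.
by rewrite !horner_rmodp_eps ?expr1n ?sqrrN ?expr1n // !hornerM !rmorphM.
Qed.
HB.instance Definition _ := GRing.isZmodMorphism.Build Zeps (rat * rat)%type
  Zeps_ev Zeps_evB.
HB.instance Definition _ := GRing.isMonoidMorphism.Build Zeps
  (rat * rat)%type Zeps_ev (Zeps_ev1, Zeps_evM).

Lemma Zeps_ev_inj : injective Zeps_ev.
Proof.
apply: raddf_inj => c [/eqP c1 /eqP cN1]; apply: val_inj => /=.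
rewrite !intr_eq0 in c1 cN1.
apply/eqP; apply: contraTT isT => nz.
have s3 : size (mk_monic eps_poly) = 3 by rewrite mk_monic_eps size_XnsubC.
have h1 : (size (\val c : {poly int}) <= 2)%N.
  have := valP c; rewrite qualifE => h; apply: leq_trans h _; by rewrite s3.
have := @max_poly_roots _ (\val c : {poly int}) [:: 1; -1] nz.
rewrite /= /root c1 cN1 /= => /(_ isT isT) h2.
by have := leq_trans h2 h1.
Qed.

(* A model of Z_eps[1/2], as a subring of Q x Q. *)
Definition Zeps_half_pred : {pred rat * rat} := fun p => boolp.asbool
  (exists (n : nat) (c : Zeps), 2 ^+ n * p = Zeps_ev c).
Lemma Zeps_half_closed : subring_closed Zeps_half_pred.
Proof.
split.
- by apply/boolp.asboolP; exists 0%N, 1; rewrite rmorph1 mul1r.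
- move=> p q /boolp.asboolP [n [c e]] /boolp.asboolP [k [d e']].
  apply/boolp.asboolP; exists (n + k)%N, (2 ^+ k * c - 2 ^+ n * d).
  rewrite rmorphB !rmorphM !rmorphXn /= rmorph_nat -e -e' mulrBr exprD.
  by rewrite !mulrA [2 ^+ k * _]mulrC.
- move=> p q /boolp.asboolP [n [c e]] /boolp.asboolP [k [d e']].
  apply/boolp.asboolP; exists (n + k)%N, (c * d).
  by rewrite rmorphM /= -e -e' exprD mulrACA.
Qed.
HB.instance Definition _ := GRing.isSubringClosed.Build (rat * rat)%type
  Zeps_half_pred Zeps_half_closed.
Record Zeps_half := ZepsHalf {
  Zeps_half_val : rat * rat;
  _ : Zeps_half_val \in Zeps_half_pred
}.
HB.instance Definition _ := [isSub for Zeps_half_val].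
HB.instance Definition _ := [Choice of Zeps_half by <:].
HB.instance Definition _ := [SubChoice_isSubComNzRing of Zeps_half by <:].
Lemma Zeps_ev_half c : Zeps_ev c \in Zeps_half_pred.
Proof. by apply/boolp.asboolP; exists 0%N, c; rewrite mul1r. Qed.
Definition Zeps_to_half c : Zeps_half := ZepsHalf (Zeps_ev_half c).
Definition Zeps_half_scale (c : Zeps) (r : Zeps_half) := Zeps_to_half c * r.
Lemma Zeps_half_scaleA a b f :
  Zeps_half_scale a (Zeps_half_scale b f) = Zeps_half_scale (a * b) f.
Proof. by apply/val_inj; rewrite /= mulrA rmorphM. Qed.
Lemma Zeps_half_scale1 : left_id 1 Zeps_half_scale.
Proof. by move=> f; apply/val_inj; rewrite /= rmorph1 mul1r. Qed.
Lemma Zeps_half_scaleDr : right_distributive Zeps_half_scale +%R.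
Proof. by move=> a f g; rewrite /Zeps_half_scale mulrDr. Qed.
Lemma Zeps_half_scaleDl f : {morph Zeps_half_scale^~ f : a b / a + b}.
Proof. by move=> a b; apply/val_inj; rewrite /= rmorphD mulrDl. Qed.
HB.instance Definition _ := GRing.Zmodule_isLmodule.Build Zeps Zeps_half
  Zeps_half_scaleA Zeps_half_scale1 Zeps_half_scaleDr Zeps_half_scaleDl.
Lemma Zeps_half_scaleAl (a : Zeps) (f g : Zeps_half) :
  a *: (f * g) = (a *: f) * g.
Proof. exact: mulrA. Qed.
HB.instance Definition _ := GRing.Lmodule_isLalgebra.Build Zeps Zeps_half
  Zeps_half_scaleAl.
HB.instance Definition _ := GRing.Lalgebra_isComAlgebra.Build Zeps Zeps_half.

Lemma Zeps_half_localization :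
  is_localization_away (2 : Zeps) (Zeps_half : comAlgType Zeps).
Proof.
have E (c : Zeps) : \val (c%:A : Zeps_half) = Zeps_ev c by rewrite /= mulr1.
split.
- have h : (2^-1, 2^-1) \in Zeps_half_pred.
    apply/boolp.asboolP; exists 1%N, 1; rewrite rmorph1 expr1.
    by apply/eqP; vm_compute.
  exists (ZepsHalf h); apply: val_inj.
  by rewrite [LHS]/= mulr1 rmorph_nat; apply/eqP; vm_compute.
- move=> r; have /boolp.asboolP [n [c e]] := valP r.
  exists n, c; apply: val_inj; rewrite E -e /= rmorphXn rmorph_nat //.
- move=> c /(congr1 val); rewrite E => h; exists 0%N; rewrite mul1r.
  by apply: Zeps_ev_inj; rewrite [LHS]h [RHS]rmorph0.
Qed.

Definition vec3 (T : Type) (x y z : T) : 'I_3 -> T := tnth [tuple x; y; z].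

Section FTL.
Variable R : comAlgType Zeps.
Implicit Types F : {poly mps R 3}.
Local Notation eps := (eps R).

Definition ps_x : mps R 3 := mps_var 0.
Definition ps_y : mps R 3 := mps_var 1.
Definition ps_z : mps R 3 := mps_var 2.

Definition ftl_neutral F : Prop :=
  let x : mps R 1 := mps_var 0 in
  tsubst F (vec3 x 0 0)
    = (1 + x *: 'X) ^+ 2 * (1 - (eps *: x) *: 'X) ^+ 2.

Definition ftl_symmetry F : Prop :=
  forall s : 'S_3, tsubst F (fun i => mps_var (s i)) = F.

(* Both substitutions have the variables x, y, z, u, v, in this order. *)
Definition ftl_associativity F : Prop :=
  exists2 H : {poly mps R 5},
    @is_substitution R 0 2 4 3 F F H & @is_substitution R 1 1 4 3 F F H.

Definition ftl_linearity F : Prop :=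
  tsubst F (vec3 (- eps *: ps_x) ps_y ps_z) = F \Po ((- eps)%:A *: 'X).

Definition ftl_weak_neutral F : Prop :=
  let x : mps R 1 := mps_var 0 in mps_subst (F`_4) (vec3 x x 0) = 0.

Record is_FTL F : Prop := IsFTL {
  FTL_series : is_series 4 F;
  FTL_neutral : ftl_neutral F;
  FTL_symmetry : ftl_symmetry F;
  FTL_associativity : ftl_associativity F;
  FTL_linearity : ftl_linearity F;
  FTL_weak_neutral : ftl_weak_neutral F
}.

Definition degree_le F (e : int) : Prop :=
  forall (l : nat) (m : 'X_{1..3}), (1 <= l <= 4)%N ->
    (F`_l : mps R 3) m != 0 -> (mdeg m)%:Z - l%:Z <= e.

(* sigma(x^i y^j z^k), the sum of the distinct monomials obtained by permuting
   the variables. *)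
Definition sigma (i j k : nat) : mps R 3 :=
  fun m => (perm_eq m [:: i; j; k])%:R.

Definition chow_witt_FTL : {poly mps R 3} :=
  let F1 := (2 * (1 - eps)) *: sigma 1 0 0 in
  let F2 := (2 * (1 - 2 * eps)) *: sigma 2 0 0
            + (2 * (1 - eps)) *: sigma 1 1 0 in
  let F3 := (2 * (1 - eps)) *: sigma 3 0 0
            - (2 * (1 - eps)) *: sigma 2 1 0
            + (8 * (2 - 3 * eps)) *: (ps_x * ps_y * ps_z) in
  let F4 := sigma 4 0 0 - (2 * (1 - eps)) *: sigma 3 1 0
            + (2 * (1 - 2 * eps)) *: sigma 2 2 0
            + (2 * (1 - eps)) *: sigma 2 1 1 in
  1 + F1 *: 'X + F2 *: 'X^2 + F3 *: 'X^3 + F4 *: 'X^4.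

End FTL.

(* Main.v *)
(* Since 2 is invertible, R embeds into Q x Q with eps = (1, -1), and a law of
   degree <= 0 is polynomial, so it can be studied on the two factors.  A
   substitution F(.., G, ..) is computed by splitting G_t = prod (1 + r_l t)
   (the r_l are the values of G) and multiplying the F_t(.., r_l, ..): the
   series Phi is unique because power series in the elementary symmetric
   functions are determined by their value, and it is polynomial when F is.

   For eps = 1, eps-linearity and the weak neutral axiom leave only the
   coefficient c of xyz t^3, and associativity at (1, 0, 1, 0, 1), where
   F_t(1, 0, 1) = 1 - 4 t^2, gives (c^2 - 64)^2 = 0.  Both c = 8 s, s = 1, -1,
   occur: the values of the law are then s (s1 x + s2 y + s3 z) for signs with
   s1 s2 s3 = 1.

   For eps = -1, write x * y = F(x, y, 0) and x * y * z = F(x, y, z).  One of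
   the values of x * x is 0, so v is a value of x * x * v; this gives linear
   relations leaving two unknown coefficients, which are determined by comparing
   third and fourth power sums of the values of 1 * 1 * v computed in two ways.
   The solution is the additive law, with
   values (a + b + c)^2, (a + b - c)^2, (a - b + c)^2, (a - b - c)^2 at
   (a^2, b^2, c^2). *)
Require Import Defs.
From HB Require Import structures.
From mathcomp Require Import all_boot all_order all_fingroup all_algebra all_field.
From mathcomp Require Import mpoly ring lra.
From mathcomp Require boolp.
Set Implicit Arguments.
Unset Strict Implicit.
Unset Printing Implicit Defensive.
Import Order.TTheory GRing.Theory Num.Theory.
Local Open Scope ring_scope.

(** * Substitution of polynomials into power series *)

Lemma rmorph_mmap n (R S S' : comNzRingType) (f : {rmorphism R -> S})
    (v : 'I_n -> S) (h : {rmorphism S -> S'}) (p : {mpoly R[n]}) :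
  h (mmap f v p) = mmap (h \o f) (h \o v) p.
Proof.
rewrite /mmap rmorph_sum; apply: eq_bigr => m _.
rewrite rmorphM /mmap1 rmorph_prod; congr (_ * _).
by apply: eq_bigr => i _; rewrite rmorphXn.
Qed.

Lemma eq_mmap n (R S : comNzRingType) (f g : R -> S) (v w : 'I_n -> S) :
  f =1 g -> v =1 w -> mmap f v =1 mmap g w.
Proof.
move=> fg vw p; apply: eq_bigr => m _; rewrite fg; congr (_ * _).
by apply: eq_bigr => i _; rewrite vw.
Qed.

Lemma mmap_mmap n k (R S : comNzRingType) (f : {rmorphism R -> S})
    (v : 'I_k -> S) (q : 'I_n -> {mpoly R[k]}) (p : {mpoly R[n]}) :
  mmap f v (mmap (@mpolyC k R) q p) = mmap f (fun i => mmap f v (q i)) p.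
Proof.
rewrite rmorph_mmap; apply: eq_mmap => // c /=.
exact: mmapC.
Qed.

Lemma mmap_idX n (R : comNzRingType) (p : {mpoly R[n]}) : mmap (@mpolyC n R) (fun i => 'X_i) p = p.
Proof.
rewrite -[RHS]comp_mpoly_id /comp_mpoly; apply: eq_mmap => // i.
by rewrite tnth_mktuple.
Qed.

Section Embedding.
Context {R : comNzRingType} {d : nat}.
Implicit Types p q : {mpoly R[d]}.

Definition mps_of_mpoly p : mps R d := fun m => p@_m.

Lemma mps_of_mpoly_is_zmod : zmod_morphism mps_of_mpoly.
Proof. by move=> p q; apply: mpsP => m; apply: mcoeffB. Qed.

Lemma mps_of_mpoly_is_monoid : monoid_morphism mps_of_mpoly.
Proof.
split; first by apply: mpsP => m; apply: mcoeff1.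
by move=> p q; apply: mpsP => m; apply: mcoeffM.
Qed.

HB.instance Definition _ := GRing.isZmodMorphism.Build {mpoly R[d]} (mps R d)
  mps_of_mpoly mps_of_mpoly_is_zmod.
HB.instance Definition _ := GRing.isMonoidMorphism.Build {mpoly R[d]} (mps R d)
  mps_of_mpoly mps_of_mpoly_is_monoid.

Lemma mps_of_mpoly_inj : injective mps_of_mpoly.
Proof.
by move=> p q e; apply/mpolyP => m; apply: (congr1 (@^~ m) e).
Qed.

Lemma mps_of_mpolyC c : mps_of_mpoly c%:MP = c%:A.
Proof. by apply: mpsP => m; apply: mcoeffC. Qed.

Lemma mps_of_mpolyZ c p : mps_of_mpoly (c *: p) = c *: mps_of_mpoly p.
Proof. by apply: mpsP => m; apply: mcoeffZ. Qed.

Lemma mps_of_mpolyX i : mps_of_mpoly 'X_i = mps_var i.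
Proof. by apply: mpsP => m; rewrite /mps_var eq_sym; apply: mcoeffX. Qed.

End Embedding.

Lemma mps_of_mpoly_mmap (R : comNzRingType) d e (q : 'I_d -> {mpoly R[e]}) p :
  mps_of_mpoly (mmap (@mpolyC e R) q p)
    = mmap (in_alg (mps R e)) (fun i => mps_of_mpoly (q i)) p.
Proof. by rewrite rmorph_mmap; apply: eq_mmap => // c; apply: mps_of_mpolyC. Qed.

(** * Substitution of series without constant term *)

Section Substitution.
Context {R : comNzRingType} {d e : nat}.
Implicit Types (f : mps R d) (p : {mpoly R[d]}) (g : 'I_d -> mps R e).

Definition ord_ge n (f : mps R e) := forall m, (mdeg m < n)%N -> f m = 0.

Lemma ord_geM n k (f g : mps R e) :
  ord_ge n f -> ord_ge k g -> ord_ge (n + k) (f * g).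
Proof.
move=> fn gk m lt_m; apply: big1 => -[i j] /= /eqP em.
have [lt_in|le_ni] := ltnP (mdeg i) n; first by rewrite fn // mul0r.
rewrite gk ?mulr0 // -(ltn_add2l n); apply: leq_ltn_trans lt_m.
have h : (mdeg i + mdeg j = mdeg m)%N by rewrite -mdegD -em.
by apply: (@leq_trans (mdeg i + mdeg j)); rewrite ?leq_add2r ?h.
Qed.

(** Every factor has order at least 1, so orders add up to at least the degree of the monomial. This
    is why the finite sum in [mps_subst] misses nothing. *)
Lemma ord_ge_mmap1 g k : (forall i, g i 0%MM = 0) -> ord_ge (mdeg k) (mmap1 g k).
Proof.
move=> g0; have -> : mdeg k = (\sum_(i < d) k i)%N by rewrite mdegE.
rewrite /mmap1; elim/big_rec2: _ => [|i n f _ IH]; first by move=> m.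
apply: ord_geM IH; elim: (k i) => [|l IH]; first by move=> m.
rewrite exprS -add1n; apply: ord_geM IH => m.
by rewrite ltnS leqn0 mdeg_eq0 => /eqP ->.
Qed.

Local Notation ev g := (mmap (in_alg (mps R e)) g).

Lemma mmap_ord_ge g p n : (forall i, g i 0%MM = 0) ->
  (forall k, (mdeg k < n)%N -> p@_k = 0) -> ord_ge n (ev g p).
Proof.
move=> g0 pn m lt_mn; rewrite /mmap.
elim/big_ind: _ => //= [u v|k _]; first by move=> u0 v0; rewrite -[LHS]/(u m + v m) u0 v0 addr0.
have [lt_kn|le_nk] := ltnP (mdeg k) n; first by rewrite pn // scale0r mul0r.
by rewrite mulr_algl -[LHS]/(_ * _) ord_ge_mmap1 ?mulr0 // (leq_trans lt_mn).
Qed.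

Lemma mps_substE f g m :
  mps_subst f g m = ev g (mps_trunc (mdeg m).+1 f) m.
Proof.
have sz : (msize (mps_trunc (mdeg m).+1 f) <= (mdeg m).+1)%N.
  rewrite /mps_trunc; apply: (leq_trans (msize_sum _ _ _)).
  by apply/bigmax_leqP_seq => k _ _; apply: leq_trans (msizeZ_le _ _) _; rewrite mmeasureX bmdeg.
rewrite (mmapE (mdeg m).+1) // /mps_subst.
have sumE (I : finType) (F : I -> mps R e) : (\sum_i F i) m = \sum_i F i m.
  by elim/big_rec2: _ => // i u v _ <-.
rewrite sumE; apply: eq_bigr => k _ /=.
by rewrite mcoeff_trunc ?bmdeg // mulr_algl.
Qed.

(** [p] and its truncation differ only in monomials of degree above [mdeg m], whose images have
    order above [mdeg m]. *)
Lemma mps_subst_poly p g : (forall i, g i 0%MM = 0) ->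
  mps_subst (mps_of_mpoly p) g = ev g p.
Proof.
move=> g0; apply: mpsP => m; rewrite mps_substE.
apply/eqP; rewrite -subr_eq0; apply/eqP.
rewrite -[LHS]/((ev g _ - ev g p) m) -rmorphB.
apply: (@mmap_ord_ge _ _ (mdeg m).+1) => // k lt_km.
by rewrite mcoeffB mcoeff_trunc // subrr.
Qed.

Lemma mps_substB f f' g : mps_subst (f - f') g = mps_subst f g - mps_subst f' g.
Proof.
apply: mpsP => m; rewrite -[RHS]/(mps_subst f g m - mps_subst f' g m).
rewrite /mps_subst -sumrB.
by apply: eq_bigr => k _; rewrite -mulrBl.
Qed.

End Substitution.

Lemma blocks_lshift (T : Type) a m b (f : 'I_a -> T) (g : 'I_m -> T) (h : 'I_b -> T) i :
  blocks f g h (lshift _ i) = f i.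
Proof. by rewrite /blocks (unsplitK (inl _ i)). Qed.

Lemma blocks_mid (T : Type) a m b (f : 'I_a -> T) (g : 'I_m -> T) (h : 'I_b -> T) j :
  blocks f g h (rshift a (lshift b j)) = g j.
Proof. by rewrite /blocks (unsplitK (inr _ _)) (unsplitK (inl _ j)). Qed.

Lemma blocks_rshift (T : Type) a m b (f : 'I_a -> T) (g : 'I_m -> T) (h : 'I_b -> T) i :
  blocks f g h (rshift a (rshift m i)) = h i.
Proof. by rewrite /blocks (unsplitK (inr _ _)) (unsplitK (inr _ i)). Qed.

Lemma blocks_comp (T U : Type) a m b (F : T -> U)
    (f : 'I_a -> T) (g : 'I_m -> T) (h : 'I_b -> T) :
  F \o blocks f g h =1 blocks (F \o f) (F \o g) (F \o h).
Proof. by move=> k; rewrite /blocks /=; case: split => // ?; case: split. Qed.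

Lemma eq_blocks (T : Type) a m b (f f' : 'I_a -> T) (g g' : 'I_m -> T) (h h' : 'I_b -> T) :
  f =1 f' -> g =1 g' -> h =1 h' -> blocks f g h =1 blocks f' g' h'.
Proof. by move=> ef eg eh k; rewrite /blocks; case: split => // ?; case: split. Qed.

Lemma blocks_eta (T : Type) a m b (x : 'I_(a + (m + b)) -> T) :
  blocks (fun i => x (lshift _ i)) (fun j => x (rshift a (lshift b j)))
    (fun i => x (rshift a (rshift m i))) =1 x.
Proof.
move=> k; rewrite /blocks -[in RHS](splitK k); case: (split k) => //= k'.
by rewrite -[in RHS](splitK k'); case: (split k').
Qed.

Lemma elem_sym_rmorph (S S' : comNzRingType) (h : {rmorphism S -> S'}) m (u : 'I_m -> S) l :
  h (elem_sym u l) = elem_sym (h \o u) l.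
Proof.
by rewrite /elem_sym rmorph_sum; apply: eq_bigr => A _; rewrite rmorph_prod.
Qed.

(** Expanding the product amounts to choosing the set of indices that contribute a factor t. *)
Lemma coef_prod_1DX (S : comNzRingType) m (u : 'I_m -> S) l :
  (\prod_(j < m) (1 + u j *: 'X))`_l = elem_sym u l.
Proof.
under eq_bigr do rewrite addrC.
rewrite bigA_distr /= coef_sum /elem_sym [RHS]big_mkcond /=.
apply: eq_bigr => A _.
have -> : \prod_i (if i \in A then u i *: 'X else 1)
    = (\prod_(i in A) u i) *: 'X^#|A| :> {poly S}.
  by rewrite -big_mkcond /= scaler_prod prodr_const.
by rewrite coefZ coefXn eq_sym; case: eqP; rewrite ?mulr1 ?mulr0.
Qed.

Lemma map_poly_comp_rmorph (S S' S'' : nzRingType) (f : {rmorphism S' -> S''})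
    (g : {rmorphism S -> S'}) (h : S -> S'') (p : {poly S}) :
  h 0 = 0 -> (forall c, f (g c) = h c) -> map_poly f (map_poly g p) = map_poly h p.
Proof.
move=> h0 fg; apply/polyP => i; rewrite (coef_map_id0 _ _ h0) -fg.
by rewrite !coef_map.
Qed.

(** * Existence and uniqueness of Phi *)

Section SymmetricSubstitution.
Context {R : comNzRingType} {a m b : nat}.
Local Notation P := {mpoly R[a + (m + b)]}.
Local Notation A := {mpoly R[a + b]}.

Definition pl (i : 'I_a) : P := 'X_(lshift _ i).
Definition pm (j : 'I_m) : P := 'X_(rshift a (lshift b j)).
Definition pr (i : 'I_b) : P := 'X_(rshift a (rshift m i)).

Definition esym_gens : 'I_(a + (m + b)) -> P :=
  blocks pl (fun j : 'I_m => elem_sym pm j.+1) pr.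

(** [to_mid] and [of_mid] identify R[x, u, x'] with A[u], where A = R[x, x'], so that the
    fundamental theorem on symmetric polynomials in the u's can be applied over the coefficient ring
    [A]. *)
Definition to_mid : P -> {mpoly A[m]} :=
  mmap (@mpolyC m A \o @mpolyC (a + b) R)
    (blocks (fun i => ('X_(lshift b i))%:MP) (fun j => 'X_j)
       (fun i => ('X_(rshift a i))%:MP)).

Definition of_outer : A -> P :=
  mmap (@mpolyC _ R)
    (fun k => match split k with inl i => pl i | inr i => pr i end).
HB.instance Definition _ := GRing.RMorphism.copy of_outer
  (mmap (@mpolyC _ R)
    (fun k => match split k with inl i => pl i | inr i => pr i end)).

Definition of_mid : {mpoly A[m]} -> P := mmap of_outer pm.
HB.instance Definition _ := GRing.RMorphism.copy of_mid (mmap of_outer pm).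
HB.instance Definition _ := GRing.RMorphism.copy to_mid
  (mmap (@mpolyC m A \o @mpolyC (a + b) R)
    (blocks (fun i => ('X_(lshift b i))%:MP) (fun j => 'X_j)
       (fun i => ('X_(rshift a i))%:MP))).

Lemma of_outerXl i : of_outer 'X_(lshift b i) = pl i.
Proof. by rewrite /of_outer mmapX mmap1U (unsplitK (inl _ i)). Qed.

Lemma of_outerXr i : of_outer 'X_(rshift a i) = pr i.
Proof. by rewrite /of_outer mmapX mmap1U (unsplitK (inr _ i)). Qed.

Lemma of_midC c : of_mid c%:MP = of_outer c.
Proof. exact: mmapC. Qed.

Lemma of_midX j : of_mid 'X_j = pm j.
Proof. by rewrite /of_mid mmapX mmap1U. Qed.

Lemma blocks_of_mid n (f : 'I_n -> {mpoly A[m]}) :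
  of_mid \o blocks (fun i => ('X_(lshift b i))%:MP) f
       (fun i => ('X_(rshift a i))%:MP) =1
  blocks pl (of_mid \o f) pr.
Proof.
move=> k; rewrite blocks_comp; apply: eq_blocks => // i /=.
  by rewrite of_midC of_outerXl.
by rewrite of_midC of_outerXr.
Qed.

Lemma to_midK : cancel to_mid of_mid.
Proof.
move=> p; rewrite /to_mid rmorph_mmap -[RHS]mmap_idX; apply: eq_mmap => [c | k].
  by rewrite /= of_midC [LHS]mmapC.
rewrite blocks_of_mid -[RHS](blocks_eta (fun k => 'X_k)).
by apply: eq_blocks => // j; rewrite /= of_midX.
Qed.

(** Under this identification, substituting [esym_gens] is composition with the elementary symmetric
    polynomials over [A]. *)
Lemma esym_gens_of_mid (q : {mpoly A[m]}) :
  mmap (@mpolyC _ R) esym_gens (of_mid q)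
    = of_mid (q \mPo [tuple mesym m A i.+1 | i < m]).
Proof.
rewrite /of_mid /comp_mpoly !rmorph_mmap; apply: eq_mmap => [c | j] /=.
  rewrite -[RHS]/(of_mid _) of_midC /of_outer rmorph_mmap; apply: eq_mmap => [r | k] /=.
    exact: mmapC.
  by case: split => i; rewrite /pl /pr mmapX mmap1U /esym_gens (blocks_lshift, blocks_rshift).
rewrite /pm mmapX mmap1U /esym_gens blocks_mid tnth_mktuple -/pm.
rewrite /mesym rmorph_sum; apply: eq_bigr => B _; rewrite rmorph_prod.
by apply: eq_bigr => i _ /=; rewrite -[RHS]/(of_mid _) of_midX.
Qed.

(** Permuting the u's permutes the factors, so every coefficient of the product is symmetric over
    [A], and [symf] writes it in the elementary symmetric polynomials. *)
Lemma symmetric_product (F : {poly {mpoly R[a + (1 + b)]}}) :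
  exists Phi : {poly P},
    \prod_(l < m) map_poly (mmap (@mpolyC _ R) (blocks pl (fun=> pm l) pr)) F
    = map_poly (mmap (@mpolyC _ R) esym_gens) Phi.
Proof.
pose ev l := mmap (@mpolyC m A \o @mpolyC (a + b) R)
  (blocks (fun i => ('X_(lshift b i))%:MP) (fun _ : 'I_1 => 'X_l)
    (fun i => ('X_(rshift a i))%:MP)).
pose Q : {poly {mpoly A[m]}} := \prod_(l < m) map_poly (ev l) F.
have symQ i : Q`_i \is symmetric.
  apply/issymP => s.
  have -> : msym s Q`_i = (map_poly (msym s) Q)`_i by rewrite coef_map.
  rewrite {2}/Q (reindex_inj (@perm_inj _ s)) /Q.
  rewrite (big_morph (map_poly (msym s)) (rmorphM _) (rmorph1 _)); congr (polyseq _)`_i.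
  apply: eq_bigr => l _; apply: map_poly_comp_rmorph => [|p]; first exact: rmorph0.
  rewrite rmorph_mmap; apply: eq_mmap => [c | k] /=.
    by rewrite [LHS]mmapC.
  rewrite -[LHS]/((msym s \o blocks _ _ _) k) blocks_comp.
  by apply: eq_blocks => i' /=; rewrite /msym (mmapX, mmapC) ?mmap1U.
pose Phi := \poly_(i < size Q) symf Q`_i.
exists (map_poly of_mid Phi); transitivity (map_poly of_mid Q).
  rewrite /Q rmorph_prod; apply: eq_bigr => l _; apply/esym.
  apply: map_poly_comp_rmorph => [|p]; first exact: rmorph0.
  rewrite rmorph_mmap; apply: eq_mmap => [c | k] /=.
    by rewrite of_midC [LHS]mmapC.
  rewrite -[LHS]/((of_mid \o blocks _ _ _) k) blocks_of_mid.
  by apply: eq_blocks => // i /=; rewrite of_midX.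
apply/polyP => i; rewrite !coef_map /= esym_gens_of_mid coef_poly.
case: ltnP => [_|le]; first by rewrite -symfP.
by rewrite (nth_default _ le) !rmorph0.
Qed.

(** The degree of the polynomial substituted for each variable: the middle variable with index j
    stands for e_(j+1). All weights are positive. *)
Definition block_weight : 'I_(a + (m + b)) -> nat :=
  blocks (fun=> 1%N) (fun j : 'I_m => j.+1) (fun=> 1%N).

Lemma dhomog_esym_gens k : esym_gens k \is (block_weight k).-homog.
Proof.
rewrite /esym_gens /block_weight /blocks; case: split => [i|k'].
  by rewrite /pl dhomogX /= mdeg1.
case: split => [j|i]; last by rewrite /pr dhomogX /= mdeg1.
rewrite rpred_sum // => B /eqP <-; rewrite -sum1_card.
elim/big_rec2: _ => [|i n p _ IH]; first exact: dhomog1.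
by apply: dhomogM IH; rewrite /pm dhomogX /= mdeg1.
Qed.

Definition bweight (k : 'X_{1..(a + (m + b))}) := (\sum_i block_weight i * k i)%N.

Lemma dhomog_mmap1_esym k : mmap1 esym_gens k \is (bweight k).-homog.
Proof.
rewrite /mmap1 /bweight; elim/big_rec2: _ => [|i n p _ IH]; first exact: dhomog1.
by apply: dhomogM IH; apply: dhomogMn; apply: dhomog_esym_gens.
Qed.

Lemma mdeg_le_bweight k : (mdeg k <= bweight k)%N.
Proof.
rewrite mdegE; apply: leq_sum => i _; apply: leq_pmull.
by rewrite /block_weight /blocks; case: split => // ?; case: split.
Qed.

Lemma of_midK : cancel of_mid to_mid.
Proof.
move=> q; rewrite /of_mid rmorph_mmap -[RHS](mmap_idX q); apply: eq_mmap => [c | j].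
  rewrite /= /of_outer rmorph_mmap -[in RHS](mmap_idX c) [RHS]rmorph_mmap.
  apply: eq_mmap => [r | k] /=; first by rewrite [LHS]mmapC.
  rewrite -[in RHS](splitK k).
  by case: split => i; rewrite /= /to_mid mmapX mmap1U (blocks_lshift, blocks_rshift).
by rewrite /= /to_mid mmapX mmap1U blocks_mid.
Qed.

(** Algebraic independence of the elementary symmetric polynomials over [A], carried through the
    identification with A[u]. *)
Lemma mmap_esym_gens_inj (p : P) : mmap (@mpolyC _ R) esym_gens p = 0 -> p = 0.
Proof.
move=> p0; rewrite -[p]to_midK [to_mid p]msym_fundamental_un0 ?rmorph0 //.
by apply: (can_inj of_midK); rewrite -esym_gens_of_mid to_midK rmorph0.
Qed.

Lemma esym_gens0 k : mps_of_mpoly (esym_gens k) 0%MM = 0.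
Proof.
apply: (dhomog_nemf_coeff (dhomog_esym_gens k)); rewrite /= mdeg0 eq_sym -lt0n.
by rewrite /block_weight /blocks; case: split => // ?; case: split.
Qed.

(* The part of weight w of f, where the variable standing for e_l has weight l,
   is a polynomial, mapped to the part of degree w of the substituted series. *)
Lemma mps_subst_esym_eq0 (f : mps R (a + (m + b))) :
  mps_subst f (fun k => mps_of_mpoly (esym_gens k)) = 0 -> f = 0.
Proof.
move=> f0; apply: mpsP => M; set w := bweight M.
pose fw : P := \sum_(k : 'X_{1..(a + (m + b)) < w.+1} | bweight k == w) f k *: 'X_[k].
have fwE k : fw@_k = if bweight k == w then f k else 0.
  rewrite /fw raddf_sum /= big_mkcond /=.
  under eq_bigr => k' _ do rewrite mcoeffZ mcoeffX.
  case: eqP => [ek|nek]; last first.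
    apply: big1 => k' _; case: eqP => // ek'; case: eqP => [ekk'|]; last by rewrite mulr0.
    by case: nek; rewrite -ekk'.
  have lt_k : (mdeg k < w.+1)%N by rewrite ltnS -ek mdeg_le_bweight.
  rewrite (bigD1 (BMultinom lt_k)) //= ek eqxx eqxx mulr1 big1 ?addr0 // => k' nk'.
  case: eqP => // _; case: eqP => [ekk'|]; last by rewrite mulr0.
  by case/eqP: nk'; apply: val_inj.
have fw0 : fw = 0.
  apply: mmap_esym_gens_inj; apply/mpolyP => N; rewrite mcoeff0.
  have coefN p : (mmap (@mpolyC _ R) esym_gens p)@_N
      = \sum_(k <- msupp p) p@_k * (mmap1 esym_gens k)@_N.
    by rewrite /mmap raddf_sum; apply: eq_bigr => k _ /=; rewrite mcoeffCM.
  have [eN|neN] := eqVneq (mdeg N) w; last first.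
    rewrite coefN big1 // => k _; rewrite fwE; case: eqP => [ek|]; last by rewrite mul0r.
    by rewrite (dhomog_nemf_coeff (dhomog_mmap1_esym k)) ?mulr0 // ek.
  have := congr1 (@^~ N) f0; rewrite mps_substE eN.
  rewrite -mps_of_mpoly_mmap -[RHS]/(0 : R) => <-; rewrite /mps_of_mpoly.
  apply/eqP; rewrite -subr_eq0 -mcoeffB -rmorphB coefN; apply/eqP.
  apply: big1 => k _; rewrite mcoeffB fwE.
  have [ek|nek] := eqVneq (bweight k) w.
    by rewrite mcoeff_trunc ?subrr ?mul0r // ltnS -ek mdeg_le_bweight.
  by rewrite (dhomog_nemf_coeff (dhomog_mmap1_esym k)) ?mulr0 //= eN eq_sym.
by rewrite -[RHS]/(0 : R) -(@mcoeff0 _ R M) -fw0 fwE eqxx.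
Qed.

End SymmetricSubstitution.

Section PolynomialSubstitution.
Context {R : comNzRingType}.

Lemma tsubst_poly d e (F : {poly {mpoly R[d]}}) (q : 'I_d -> {mpoly R[e]}) (g : 'I_d -> mps R e) :
  (forall i, g i = mps_of_mpoly (q i)) -> (forall i, (q i)@_0%MM = 0) ->
  tsubst (map_poly mps_of_mpoly F) g
    = map_poly mps_of_mpoly (map_poly (mmap (@mpolyC e R) q) F).
Proof.
move=> gq q0; have -> : g = fun i => mps_of_mpoly (q i) by apply/boolp.funext.
rewrite /tsubst; apply/polyP => i.
have s0 : mps_subst 0 (fun i => mps_of_mpoly (q i)) = 0 :> mps R e.
  by rewrite -(rmorph0 mps_of_mpoly) mps_subst_poly // rmorph0.
rewrite (coef_map_id0 _ _ s0) !coef_map /= mps_subst_poly //.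
by rewrite mps_of_mpoly_mmap.
Qed.

Lemma tsubst_inj d e (F F' : {poly mps R d}) (g : 'I_d -> mps R e) :
  (forall f, mps_subst f g = 0 -> f = 0) ->
  tsubst F g = tsubst F' g -> F = F'.
Proof.
move=> g_inj /polyP FF'; apply/polyP => i; apply/eqP; rewrite -subr_eq0.
have s0 : mps_subst 0 g = 0 by rewrite -[X in mps_subst X _](subrr 0) mps_substB subrr.
apply/eqP/g_inj; rewrite mps_substB.
by have := FF' i; rewrite !(coef_map_id0 _ _ s0) => ->; rewrite subrr.
Qed.

(** A polynomial Phi exists by [symmetric_product], and it is the only power series solution by
    [mps_subst_esym_eq0]; hence the substitution has exactly one result. The second part computes
    this result at any point where G_t splits into linear factors. *)
Lemma is_substitution_poly a b m r (F : {poly {mpoly R[a + (1 + b)]}}) (G : {poly {mpoly R[r]}}) :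
    is_series m (map_poly mps_of_mpoly G) -> composable (map_poly mps_of_mpoly G) ->
  exists2 H : {poly {mpoly R[a + (r + b)]}},
    forall K, @is_substitution R a b m r (map_poly mps_of_mpoly F) (map_poly mps_of_mpoly G) K
       <-> K = map_poly mps_of_mpoly H
  & forall (S : comNzRingType) (f : {rmorphism R -> S}) (v : 'I_a -> S) (y : 'I_r -> S)
      (w : 'I_b -> S) (u : 'I_m -> S),
      map_poly (mmap f y) G = \prod_(l < m) (1 + u l *: 'X) ->
      map_poly (mmap f (blocks v y w)) H
        = \prod_(l < m) map_poly (mmap f (blocks v (fun=> u l) w)) F.
Proof.
move=> serG compG; have [Phi PhiE] := @symmetric_product R a m b F.
pose q : 'I_(a + (m + b)) -> {mpoly R[a + (r + b)]} :=
  blocks pl (fun j : 'I_m => mmap (@mpolyC _ R) pm G`_j.+1) pr.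
have pm0 c (k : 'I_c) : ('X_k : {mpoly R[c]})@_0%MM = 0.
  by rewrite mcoeffX; case: eqP => // /(congr1 (@mdeg c)); rewrite mdeg1 mdeg0.
have G0 (j : 'I_m) : G`_j.+1@_0%MM = 0.
  by have := compG j.+1 isT; rewrite coef_map.
have varE c (i : 'I_c) : mps_var i = mps_of_mpoly 'X_i :> mps R c.
  by rewrite mps_of_mpolyX.
have qE k : blocks lvar (fun j : 'I_m => mps_subst ((map_poly mps_of_mpoly G)`_j.+1)
      (mvar : 'I_r -> _)) rvar k = mps_of_mpoly (q k) :> mps R (a + (r + b)).
  rewrite /q -[RHS]/((mps_of_mpoly \o blocks _ _ _) k) blocks_comp.
  apply: eq_blocks => [i|j|i] /=; try exact: varE.
  have -> : mvar = fun j => mps_of_mpoly (pm j) :> mps R (a + (r + b)).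
    by apply/boolp.funext => j'; apply: varE.
  rewrite coef_map /= mps_subst_poly => [|i]; last exact: pm0.
  by rewrite mps_of_mpoly_mmap.
have q0 k : (q k)@_0%MM = 0.
  rewrite /q /blocks; case: split => [i|k']; first exact: pm0.
  case: split => [j|i]; last exact: pm0.
  rewrite -[LHS]/(mps_of_mpoly _ 0%MM) mps_of_mpoly_mmap.
  apply: (@mmap_ord_ge _ _ _ _ _ 1) => [i|n0|]; rewrite ?mdeg0 //; first exact: pm0.
  by rewrite ltnS leqn0 mdeg_eq0 => /eqP ->.
have gensE k : blocks lvar (fun j : 'I_m => elem_sym mvar j.+1) rvar k
    = mps_of_mpoly (esym_gens k) :> mps R (a + (m + b)).
  rewrite /esym_gens -[RHS]/((mps_of_mpoly \o blocks _ _ _) k) blocks_comp.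
  apply: eq_blocks => [i|j|i] /=; try exact: varE.
  by rewrite elem_sym_rmorph; congr elem_sym; apply/boolp.funext => j'; apply: varE.
have PhiE' : \prod_(l < m) tsubst (map_poly mps_of_mpoly F) (blocks lvar (fun=> mvar l) rvar)
    = tsubst (map_poly mps_of_mpoly Phi)
        (blocks lvar (fun j : 'I_m => elem_sym mvar j.+1) rvar) :> {poly mps R (a + (m + b))}.
  rewrite (tsubst_poly Phi gensE) => [|k]; last exact: esym_gens0.
  rewrite -PhiE (big_morph (map_poly mps_of_mpoly) (rmorphM _) (rmorph1 _)).
  apply: eq_bigr => l _; apply: tsubst_poly => k.
    rewrite -[RHS]/((mps_of_mpoly \o blocks _ _ _) k) blocks_comp.
    by apply: eq_blocks => [i|j|i] /=; apply: varE.
  by rewrite /blocks; case: split => [i|k']; [|case: split => i]; apply: pm0.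
have gens_inj f : mps_subst f (blocks lvar (fun j : 'I_m => elem_sym mvar j.+1) rvar)
    = 0 :> mps R (a + (m + b)) -> f = 0.
  by move=> f0; apply: mps_subst_esym_eq0; rewrite -[RHS]f0; congr mps_subst;
    apply/boolp.funext => k; rewrite gensE.
exists (map_poly (mmap (@mpolyC _ R) q) Phi) => [K|S f v y w u GE].
  split=> [[_ _ [Phi' Phi'E ->]]|->].
    have -> : Phi' = map_poly mps_of_mpoly Phi.
      by apply: (tsubst_inj gens_inj); rewrite -Phi'E -PhiE'.
    exact: tsubst_poly.
  split=> //; exists (map_poly mps_of_mpoly Phi) => //.
  by apply/esym/tsubst_poly.
(* Vieta: where G_t splits, its coefficients are the elementary symmetric functions of the [u l], so
   H takes there the value of Phi at these functions. *)
have esymE (j : 'I_m) : mmap f y G`_j.+1 = elem_sym u j.+1.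
  by rewrite -coef_prod_1DX -GE coef_map.
have := congr1 (map_poly (mmap f (blocks v u w))) PhiE.
rewrite (big_morph (map_poly (mmap f (blocks v u w))) (rmorphM _) (rmorph1 _)).
under eq_bigr => l _.
  rewrite (@map_poly_comp_rmorph _ _ _ _ _ (mmap f (blocks v (fun=> u l) w))); last 2 first.
  - exact: rmorph0.
  - move=> p; rewrite /= mmap_mmap; apply: eq_mmap => // k.
    rewrite -[LHS]/((mmap f _ \o blocks _ _ _) k) blocks_comp.
    by apply: eq_blocks => i /=;
      rewrite mmapX mmap1U (blocks_lshift, blocks_mid, blocks_rshift).
  over.
move=> ->; apply/polyP => i; rewrite !coef_map /= !mmap_mmap; apply: eq_mmap => // k.
rewrite /q /esym_gens -[LHS]/((mmap f _ \o blocks _ _ _) k)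
  -[RHS]/((mmap f _ \o blocks _ _ _) k) !blocks_comp.
apply: eq_blocks => j /=; rewrite ?mmapX ?mmap1U ?blocks_lshift ?blocks_rshift //.
rewrite mmap_mmap elem_sym_rmorph -[RHS](_ : elem_sym u j.+1 = _); last first.
  by congr elem_sym; apply/boolp.funext => j'; rewrite /= mmapX mmap1U blocks_mid.
by rewrite -esymE; apply: eq_mmap => // j'; rewrite mmapX mmap1U blocks_mid.
Qed.

End PolynomialSubstitution.

(** * The ring Z_eps[1/2] and the explicit laws *)

Lemma Zeps_ev_eps : Zeps_ev Zeps_eps = (1, -1).
Proof.
rewrite /Zeps_ev /Zeps_eps /= /qpolyX /=.
by rewrite !horner_rmodp_eps ?sqrrN ?expr1n // !hornerX.
Qed.

(** * Embedding of a localization into Q x Q *)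

Section Embedding.
Variables (R : comAlgType Zeps) (R_loc : is_localization_away (2 : Zeps) R).

Let halfP : (2 : rat * rat) * (2^-1, 2^-1) = 1.
Proof. by apply/eqP; vm_compute. Qed.

Let pow2I n : injective (fun q : rat * rat => 2 ^+ n * q).
Proof.
move=> q q' /(congr1 ( *%R ((2^-1, 2^-1) ^+ n))).
by rewrite !mulrA -!exprMn_comm ?[_ * 2]mulrC ?halfP ?expr1n ?mul1r //; apply: mulrC.
Qed.

(** The graph of the embedding: the same fraction c / 2^n, read in [R] and in Q x Q. As [R] is given
    only by the properties of a localization, the map comes from showing that this relation is
    functional. *)
Let rel (r : R) (q : rat * rat) :=
  exists (n : nat) (c : Zeps), 2 ^+ n *: r = c%:A /\ 2 ^+ n * q = Zeps_ev c.

Let rel_total r : exists q, rel r q.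
Proof.
have [_ /(_ r) [n [c rE]] _] := R_loc.
exists ((2^-1, 2^-1) ^+ n * Zeps_ev c), n, c; split=> //.
by rewrite mulrA -exprMn_comm ?halfP ?expr1n ?mul1r //; apply: mulrC.
Qed.

Let ev_pow2 n : Zeps_ev (2 ^+ n) = 2 ^+ n.
Proof. by rewrite rmorphXn rmorph_nat. Qed.

(** Two numerators of the same element agree after cross-multiplication, up to an element killed by
    a power of 2; powers of 2 cancel in Q x Q. *)
Let rel_fun r q q' : rel r q -> rel r q' -> q = q'.
Proof.
move=> [n [c [rc qc]]] [k [d [rd qd]]].
have [_ _ /(_ (2 ^+ k * c - 2 ^+ n * d)) tors] := R_loc.
have [|l] := tors.
  by rewrite scalerBl -!scalerA -rc -rd !scalerA mulrC subrr.
move/(congr1 Zeps_ev); rewrite rmorphM rmorphB !rmorphM rmorph0 /= !ev_pow2 -qc -qd.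
rewrite !mulrA [2 ^+ n * _]mulrC -mulrBr !mulrA -!exprD.
move=> qq'; apply/eqP; rewrite -subr_eq0; apply/eqP.
by apply: (@pow2I (l + k + n)); rewrite qq' mulr0.
Qed.

Let relB r r' q q' : rel r q -> rel r' q' -> rel (r - r') (q - q').
Proof.
move=> [n [c [rc qc]]] [k [d [rd qd]]].
exists (n + k)%N, (2 ^+ k * c - 2 ^+ n * d); split.
  by rewrite scalerBl -!scalerA -rc -rd !scalerA -!exprD scalerBr [(k + n)%N]addnC.
by rewrite rmorphB !rmorphM /= !ev_pow2 -qc -qd !mulrA -!exprD mulrBr [(k + n)%N]addnC.
Qed.

Let relM r r' q q' : rel r q -> rel r' q' -> rel (r * r') (q * q').
Proof.
move=> [n [c [rc qc]]] [k [d [rd qd]]].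
exists (n + k)%N, (c * d); split.
  by rewrite exprD -scalerA scalerAr rd scalerAl rc -scalerAl mul1r scalerA.
by rewrite rmorphM /= -qc -qd exprD mulrACA.
Qed.

Let rel_alg c : rel c%:A (Zeps_ev c).
Proof. by exists 0%N, c; rewrite scale1r mul1r. Qed.

Let psi r := sval (boolp.cid (rel_total r)).
Let psiP r : rel r (psi r).
Proof. exact: (svalP (boolp.cid (rel_total r))). Qed.

Let psi_zmod : zmod_morphism psi.
Proof. by move=> r r'; apply: rel_fun (psiP _) (relB (psiP r) (psiP r')). Qed.

Let psi_monoid : monoid_morphism psi.
Proof.
split=> [|r r']; last by apply: rel_fun (psiP _) (relM (psiP r) (psiP r')).
by apply: rel_fun (psiP _) _; rewrite -Zeps_ev1 -(scale1r (1 : R)); apply: rel_alg.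
Qed.

(** For injectivity: if the image is 0, so is the numerator, because [Zeps_ev] is injective; then r
    = 0, because 2 is invertible in [R]. *)
Lemma localization_embedding : exists f : {rmorphism R -> (rat * rat)%type},
  injective f /\ f (eps R) = (1, -1).
Proof.
pose f : {rmorphism R -> (rat * rat)%type} := HB.pack psi
  (GRing.isZmodMorphism.Build _ _ psi psi_zmod)
  (GRing.isMonoidMorphism.Build _ _ psi psi_monoid).
exists f; split; last first.
  by rewrite -Zeps_ev_eps; apply: rel_fun (psiP _) (rel_alg _).
apply: raddf_inj => r fr0.
have [n [c []]] := psiP r; rewrite [psi r]fr0 mulr0 -(rmorph0 Zeps_ev) => rc /Zeps_ev_inj c0.
have [[v v2] _ _] := R_loc.
rewrite -[r]mul1r -(expr1n _ n) -v2 exprMn exprZn expr1n.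
by rewrite mulrAC -scalerAl mul1r rc -c0 scale0r mul0r.
Qed.

End Embedding.

Lemma eq_from_pair (T : Type) (S S' : Type) (f : T -> S * S') (x y : T) :
  injective f -> (f x).1 = (f y).1 -> (f x).2 = (f y).2 -> x = y.
Proof. by move=> f_inj e1 e2; apply: f_inj; case: (f x) (f y) e1 e2 => ? ? [? ?] /= -> ->. Qed.

(* c is the coefficient of xyz t^3, the only one that distinguishes the two laws. *)
Definition law (S : comNzRingType) (e c x y z : S) : {poly S} :=
  1 + (2 * (1 - e) * (x + y + z)) *: 'X
    + (2 * (1 - 2 * e) * (x ^+ 2 + y ^+ 2 + z ^+ 2)
       + 2 * (1 - e) * (x * y + y * z + x * z)) *: 'X^2
    + (2 * (1 - e) * (x ^+ 3 + y ^+ 3 + z ^+ 3)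
       - 2 * (1 - e) * (x ^+ 2 * (y + z) + y ^+ 2 * (x + z) + z ^+ 2 * (x + y))
       + c * (x * y * z)) *: 'X^3
    + (x ^+ 4 + y ^+ 4 + z ^+ 4
       - 2 * (1 - e) * (x ^+ 3 * (y + z) + y ^+ 3 * (x + z) + z ^+ 3 * (x + y))
       + 2 * (1 - 2 * e) * (x ^+ 2 * y ^+ 2 + y ^+ 2 * z ^+ 2 + x ^+ 2 * z ^+ 2)
       + 2 * (1 - e) * (x ^+ 2 * y * z + y ^+ 2 * x * z + z ^+ 2 * x * y)) *: 'X^4.

Lemma map_law (S S' : comNzRingType) (h : {rmorphism S -> S'}) e c x y z :
  map_poly h (law e c x y z) = law (h e) (h c) (h x) (h y) (h z).
Proof.
rewrite /law; apply/polyP => i; rewrite coef_map /=.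
rewrite !(coefD, coefZ, coef1, coefX, coefXn).
by ring.
Qed.

Lemma sum_eq_mem (R : nzRingType) (T : eqType) (r : seq T) x :
  uniq r -> \sum_(t <- r) (t == x)%:R = (x \in r)%:R :> R.
Proof.
elim: r => [|t r IH] /=; first by rewrite big_nil.
move=> /andP[tr ur]; rewrite big_cons IH // inE eq_sym.
by case: eqP => [->|] /=; rewrite ?add0r // (negPf tr) addr0.
Qed.

(** [permutations] lists every rearrangement once, even when exponents repeat, so each distinct
    monomial is counted once, as in [sigma]. *)
Definition monomial_sum (S : comNzRingType) (x y z : S) (s : seq nat) : S :=
  \sum_(t <- permutations s) x ^+ nth 0%N t 0 * y ^+ nth 0%N t 1 * z ^+ nth 0%N t 2.

Lemma monomial_sumE (S : comNzRingType) (x y z : S) :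
  (monomial_sum x y z [:: 0; 0; 0]%N = 1) *
  (monomial_sum x y z [:: 1; 0; 0]%N = x + y + z) *
  (monomial_sum x y z [:: 2; 0; 0]%N = x ^+ 2 + y ^+ 2 + z ^+ 2) *
  (monomial_sum x y z [:: 1; 1; 0]%N = x * y + y * z + x * z) *
  (monomial_sum x y z [:: 3; 0; 0]%N = x ^+ 3 + y ^+ 3 + z ^+ 3) *
  (monomial_sum x y z [:: 2; 1; 0]%N
    = x ^+ 2 * (y + z) + y ^+ 2 * (x + z) + z ^+ 2 * (x + y)) *
  (monomial_sum x y z [:: 1; 1; 1]%N = x * y * z) *
  (monomial_sum x y z [:: 4; 0; 0]%N = x ^+ 4 + y ^+ 4 + z ^+ 4) *
  (monomial_sum x y z [:: 3; 1; 0]%N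
    = x ^+ 3 * (y + z) + y ^+ 3 * (x + z) + z ^+ 3 * (x + y)) *
  (monomial_sum x y z [:: 2; 2; 0]%N
    = x ^+ 2 * y ^+ 2 + y ^+ 2 * z ^+ 2 + x ^+ 2 * z ^+ 2) *
  (monomial_sum x y z [:: 2; 1; 1]%N
    = x ^+ 2 * y * z + y ^+ 2 * x * z + z ^+ 2 * x * y).
Proof.
rewrite /monomial_sum.
by do 10![split; last by rewrite !big_cons big_nil /=; ring]; rewrite !big_cons big_nil /=; ring.
Qed.

Section Sigma.
Variable R : comAlgType Zeps.

Lemma sigmaE i j k :
  sigma R i j k = monomial_sum (ps_x R) (ps_y R) (ps_z R) [:: i; j; k].
Proof.
rewrite /monomial_sum.
have xE (a b c : nat) : ps_x R ^+ a * ps_y R ^+ b * ps_z R ^+ c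
    = mps_of_mpoly 'X_[[multinom [tuple a; b; c]]].
  rewrite [in RHS]mpolyXE_id !big_ord_recl big_ord0 mulr1 !rmorphM !rmorphXn /=.
  by rewrite !mps_of_mpolyX mulrA; congr (_ * _ * _); congr (mps_var _ ^+ _); apply: val_inj.
apply: mpsP => m.
have -> (I : Type) (r : seq I) (F : I -> mps R 3) : (\sum_(l <- r) F l) m = \sum_(l <- r) F l m.
  by elim/big_rec2: _ => // l u v _ <-.
transitivity (\sum_(s <- permutations [:: i; j; k]) (s == m :> seq nat)%:R : R); last first.
  apply: eq_big_seq => s; rewrite mem_permutations => /perm_size /=.
  case: s => [|a [|b [|c []]]] //= _.
  rewrite xE /mps_of_mpoly mcoeffX.
  have -> : ([multinom [tuple a; b; c]] == m) = ([:: a; b; c] == m :> seq nat).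
    by apply/eqP/eqP => [<- //|h]; do 2!apply: val_inj.
  by [].
by rewrite /sigma -mem_permutations; apply/esym/sum_eq_mem/permutations_uniq.
Qed.

Lemma chow_witt_law : chow_witt_FTL R
  = law (in_alg (mps R 3) (eps R)) (in_alg (mps R 3) (8 * (2 - 3 * eps R)))
      (ps_x R) (ps_y R) (ps_z R).
Proof.
have Z (k : R) (f : mps R 3) : k *: f = in_alg _ k * f by rewrite mulr_algl.
rewrite /chow_witt_FTL /law !(Z _ (sigma _ _ _ _)) (Z _ (_ * _)).
rewrite !sigmaE !monomial_sumE.
by congr (_ + _ + _ + _ + _); congr (_ *: _); ring.
Qed.
End Sigma.

(** * The explicit laws are formal ternary laws *)

Definition vec5 (T : Type) (x y z u v : T) : 'I_5 -> T := tnth [tuple x; y; z; u; v].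

(** * The axioms for polynomial series *)

Section PolynomialLaws.
Variable R : comAlgType Zeps.
Implicit Types F : {poly {mpoly R[3]}}.
Local Notation eps := (eps R).
Local Notation iota F := (map_poly mps_of_mpoly F).

Definition ev3 (S : comNzRingType) (f : R -> S) (x y z : S) F : {poly S} :=
  map_poly (mmap f (vec3 x y z)) F.

Lemma iota_inj d : injective (map_poly (@mps_of_mpoly R d)).
Proof. by apply: map_inj_poly (rmorph0 _); apply: mps_of_mpoly_inj. Qed.

Lemma mpolyX0 d (k : 'I_d) : ('X_k : {mpoly R[d]})@_0%MM = 0.
Proof. by rewrite mcoeffX; case: eqP => // /(congr1 (@mdeg d)); rewrite mdeg1 mdeg0. Qed.

Lemma map_vec3 (T T' : Type) (h : T -> T') x y z i :
  vec3 (h x) (h y) (h z) i = h (vec3 x y z i).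
Proof. by case: i => [[|[|[|]]]]. Qed.

Lemma vec3_ind (T : Type) (P : T -> Prop) x y z i : P x -> P y -> P z -> P (vec3 x y z i).
Proof. by case: i => [[|[|[|]]]]. Qed.

Lemma tsubst_vec3 d F (x y z : {mpoly R[d]}) : x@_0%MM = 0 -> y@_0%MM = 0 -> z@_0%MM = 0 ->
  tsubst (iota F) (vec3 (mps_of_mpoly x) (mps_of_mpoly y) (mps_of_mpoly z))
   = iota (ev3 (@mpolyC d R) x y z F).
Proof.
move=> x0 y0 z0; apply: tsubst_poly => i; first exact: map_vec3.
by apply: (vec3_ind (P := fun p : {mpoly R[d]} => p@_0%MM = 0)).
Qed.

Lemma ev3_ev3 d (S : comNzRingType) (f : {rmorphism R -> S}) (v : 'I_d -> S) x y z F :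
  map_poly (mmap f v) (ev3 (@mpolyC d R) x y z F)
   = ev3 f (mmap f v x) (mmap f v y) (mmap f v z) F.
Proof.
apply: map_poly_comp_rmorph => [|p]; first exact: rmorph0.
by rewrite /= mmap_mmap; apply: eq_mmap => // i; rewrite map_vec3.
Qed.

Lemma ftl_neutral_poly F : ftl_neutral (iota F) <->
  ev3 (@mpolyC 1 R) 'X_ord0 0 0 F = (1 + 'X_ord0 *: 'X) ^+ 2 * (1 - (eps *: 'X_ord0) *: 'X) ^+ 2.
Proof.
rewrite /ftl_neutral -(mps_of_mpolyX 0) -(rmorph0 mps_of_mpoly) tsubst_vec3 ?mpolyX0 ?mcoeff0 //.
rewrite -mps_of_mpolyZ -(map_polyX mps_of_mpoly) -!map_polyZ.
rewrite -(rmorph1 (map_poly mps_of_mpoly)) -rmorphD -rmorphB -!rmorphXn -rmorphM.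
by split=> [/iota_inj -> //|->].
Qed.

Lemma ftl_symmetry_poly F : ftl_symmetry (iota F) <-> forall s : 'S_3, map_poly (msym s) F = F.
Proof.
have E (s : 'S_3) : tsubst (iota F) (fun i => mps_var (s i)) = iota (map_poly (msym s) F).
  by apply: tsubst_poly => i; rewrite ?mps_of_mpolyX ?mpolyX0.
split=> [h s|h s]; first by apply: iota_inj; rewrite -E h.
by rewrite E h.
Qed.

Lemma ftl_linearity_poly F : ftl_linearity (iota F) <->
  ev3 (@mpolyC 3 R) (- eps *: 'X_0) 'X_1 'X_2 F = F \Po ((- eps)%:MP *: 'X).
Proof.
rewrite /ftl_linearity /ps_x /ps_y /ps_z -!mps_of_mpolyX -mps_of_mpolyZ.
rewrite tsubst_vec3 ?mcoeffZ ?mpolyX0 ?mulr0 //.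
rewrite -mps_of_mpolyC -(map_polyX mps_of_mpoly) -map_polyZ -map_comp_poly.
by split=> [/iota_inj -> //|->].
Qed.

Lemma ftl_weak_neutral_poly F : ftl_weak_neutral (iota F) <->
  (ev3 (@mpolyC 1 R) 'X_ord0 'X_ord0 0 F)`_4 = 0.
Proof.
have := @tsubst_vec3 1 F 'X_ord0 'X_ord0 0 (mpolyX0 _) (mpolyX0 _) (mcoeff0 _ _).
move=> /(congr1 (fun p : {poly mps R 1} => p`_4)).
rewrite /tsubst coef_map_id0; last first.
  by rewrite -[X in mps_subst X _](subrr 0) mps_substB subrr.
rewrite /ftl_weak_neutral -(mps_of_mpolyX 0) rmorph0 => ->; rewrite [X in X = 0 <-> _]coef_map.
split=> [|->]; last exact: rmorph0.
by rewrite -[X in _ = X -> _](rmorph0 mps_of_mpoly) => /mps_of_mpoly_inj.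
Qed.

(** The two sides of associativity are polynomials in five variables. Wherever the inner law splits,
    they are products over its values; associativity is used only through these formulas. *)
Lemma ftl_associativity_poly F : is_series 4 (iota F) -> composable (iota F) ->
  exists H1 H2 : {poly {mpoly R[5]}}, [/\ ftl_associativity (iota F) <-> H1 = H2,
    forall (S : comNzRingType) (f : {rmorphism R -> S}) x y z u v (r : 'I_4 -> S),
      ev3 f x y z F = \prod_(l < 4) (1 + r l *: 'X) ->
      map_poly (mmap f (vec5 x y z u v)) H1 = \prod_(l < 4) ev3 f (r l) u v F
  & forall (S : comNzRingType) (f : {rmorphism R -> S}) x y z u v (r : 'I_4 -> S),
      ev3 f y z u F = \prod_(l < 4) (1 + r l *: 'X) ->
      map_poly (mmap f (vec5 x y z u v)) H2 = \prod_(l < 4) ev3 f x (r l) v F].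
Proof.
move=> serF compF.
have [H1 H1P H1E] := @is_substitution_poly R 0 2 4 3 F F serF compF.
have [H2 H2P H2E] := @is_substitution_poly R 1 1 4 3 F F serF compF.
exists H1, H2; split=> [|S f x y z u v r rE|S f x y z u v r rE].
- split=> [[H /H1P -> /H2P /iota_inj //]|H12].
  by exists (iota H1); [apply/H1P|apply/H2P; rewrite H12].
- pose w : 'I_2 -> S := tnth [tuple u; v].
  have := H1E S f (fun=> 0) (vec3 x y z) w r rE.
  have -> : map_poly (mmap f (blocks (fun=> 0) (vec3 x y z) w)) H1
     = map_poly (mmap f (vec5 x y z u v)) H1.
    apply: eq_map_poly => p; apply: eq_mmap => // k; rewrite -[RHS](@blocks_eta _ 0 3 2).
    by apply: eq_blocks => [[]//|[[|[|[|]]]]|[[|[|]]]] //.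
  move=> ->; apply: eq_bigr => l _; apply: eq_map_poly => p; apply: eq_mmap => // k.
  rewrite -[RHS](@blocks_eta _ 0 1 2).
  by apply: eq_blocks => [[]//|[[|]]|[[|[|]]]] //.
pose w : 'I_1 -> S := tnth [tuple v]; pose t : 'I_1 -> S := tnth [tuple x].
have := H2E S f t (vec3 y z u) w r rE.
have -> : map_poly (mmap f (blocks t (vec3 y z u) w)) H2
   = map_poly (mmap f (vec5 x y z u v)) H2.
  apply: eq_map_poly => p; apply: eq_mmap => // k; rewrite -[RHS](@blocks_eta _ 1 3 1).
  by apply: eq_blocks => [[[|]]//|[[|[|[|]]]]|[[|]]] //.
move=> ->; apply: eq_bigr => l _; apply: eq_map_poly => p; apply: eq_mmap => // k.
rewrite -[RHS](@blocks_eta _ 1 1 1).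
by apply: eq_blocks => [[[|]]//|[[|]]|[[|]]] //.
Qed.
End PolynomialLaws.

(** * Identities of the explicit laws *)

Section LawIdentities.
Variable S : comNzRingType.
Implicit Types x y z c e s : S.

Lemma law_neutral e c x : e ^+ 2 = 1 ->
  law e c x 0 0 = (1 + x *: 'X) ^+ 2 * (1 - (e * x) *: 'X) ^+ 2.
Proof.
move=> e2; pose d := (- (1 - e ^+ 2)  * x ^+ 4) *: ('X^4 : {poly S}).
rewrite /law -!mul_polyC.
have -> : (1 + x%:P * 'X) ^+ 2 * (1 - (e * x)%:P * 'X) ^+ 2
  = 1 + (2 * (1 - e) * x)%:P * 'X + ((1 - 4 * e + e ^+ 2) * x ^+ 2)%:P * 'X^2
   + (2 * (e ^+ 2 - e) * x ^+ 3)%:P * 'X^3 + (e ^+ 2 * x ^+ 4)%:P * 'X^4 :> {poly S} by ring.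
rewrite e2; congr (_ + _ * _ + _ * _ + _ * _ + _ * _); congr (_%:P); ring.
Qed.

Lemma law_perm e c (v : 'I_3 -> S) (s : 'S_3) :
  law e c (v (s 0)) (v (s 1)) (v (s 2)) = law e c (v 0) (v 1) (v 2).
Proof.
have I3 (i : 'I_3) : [\/ i = 0, i = 1 | i = 2].
  case: i => [[|[|[|//]]]] p; [constructor 1|constructor 2|constructor 3]; exact: val_inj.
have ne i j : i != j -> s i != s j by rewrite (inj_eq (@perm_inj _ s)).
have /eqP n01 := ne 0 1 isT; have /eqP n02 := ne 0 2 isT; have /eqP n12 := ne 1 2 isT.
move: n01 n02 n12.
by case: (I3 (s 0)) => ->; case: (I3 (s 1)) => ->; case: (I3 (s 2)) => -> //= _ _ _;
  rewrite // /law; congr (_ + _ *: _ + _ *: _ + _ *: _ + _ *: _); ring.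
Qed.

Lemma law_linear e c x y z : e ^+ 2 = 1 ->
  law e c (- e * x) y z = law e c x y z \Po ((- e) *: 'X).
Proof.
(* The coefficients on the two sides differ by multiples of 1 - e^2; the cofactors are given
   explicitly at the end. *)
move=> e2; have k t : (1 - e ^+ 2) * t = 0 by rewrite e2 subrr mul0r.
have e3 : (- e) ^+ 3 = - e by rewrite exprS sqrrN e2 mulr1.
have e4 : (- e) ^+ 4 = 1 by rewrite (exprM _ 2 2) sqrrN e2 expr1n.
rewrite /law !linearD !linearZ /= !rmorphXn rmorph1 /= comp_polyX !exprZn.
rewrite !exprMn sqrrN e3 e4 e2 !mul1r !scalerA.
congr (_ + _ *: _ + _ *: _ + _ *: _ + _ *: _); apply/eqP; rewrite -subr_eq0; apply/eqP.
- by rewrite -[RHS](k (2 * (y + z))); ring.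
- by rewrite -[RHS](k (- 2 * (x * y + x * z))); ring.
- rewrite -[RHS](k (2 * (y ^+ 3 + z ^+ 3)
    - 2 * (x ^+ 2 * (y + z) + y ^+ 2 * z + y * z ^+ 2))); ring.
- rewrite -[RHS](k (2 * (x ^+ 3 * (y + z) + x * (y ^+ 3 + z ^+ 3))
    - 2 * (x * y ^+ 2 * z + x * y * z ^+ 2))); ring.
Qed.

Lemma law_weak e c x : e ^+ 2 = 1 -> (law e c x x 0)`_4 = 0.
Proof.
move=> e2; rewrite /law !(coefD, coefZ, coef1, coefX, coefXn) /=; ring.
Qed.

Lemma law1_factor s x y z : s = 1 \/ s = -1 ->
  law 1 (8 * s) x y z
  = (1 + (s * (x + y + z)) *: 'X) * (1 + (s * (x - y - z)) *: 'X)
    * (1 + (s * (- x + y - z)) *: 'X) * (1 + (s * (- x - y + z)) *: 'X).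
Proof. by case=> ->; rewrite /law -!mul_polyC; ring. Qed.

Lemma lawN1_factor x y z :
  law (-1) 40 (x ^+ 2) (y ^+ 2) (z ^+ 2)
  = (1 + ((x + y + z) ^+ 2) *: 'X) * (1 + ((x + y - z) ^+ 2) *: 'X)
    * (1 + ((x - y + z) ^+ 2) *: 'X) * (1 + ((x - y - z) ^+ 2) *: 'X).
Proof. by rewrite /law -!mul_polyC; ring. Qed.

End LawIdentities.

(** * Associativity on values *)

Section Associativity.
Variable S : comNzRingType.
Implicit Types x y z u v s : S.

Lemma prod4 (T : comNzRingType) (F : 'I_4 -> T) : \prod_(l < 4) F l = F 0 * F 1 * F 2 * F 3.
Proof.
rewrite !big_ord_recl big_ord0 mulr1 !mulrA.
by congr (F _ * F _ * F _ * F _); apply: val_inj.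
Qed.

Definition vec4 (T : Type) (x y z t : T) : 'I_4 -> T := tnth [tuple x; y; z; t].

Definition law1_roots s x y z :=
  vec4 (s * (x + y + z)) (s * (x - y - z)) (s * (- x + y - z)) (s * (- x - y + z)).

Lemma law1_roots_assoc s x y z u v : s = 1 \/ s = -1 ->
  \prod_(l < 4) law 1 (8 * s) (law1_roots s x y z l) u v
  = \prod_(l < 4) law 1 (8 * s) x (law1_roots s y z u l) v.
Proof.
move=> s1; rewrite !prod4 !(law1_factor _ _ _ s1) /law1_roots /vec4 !(tnth_nth 0) /=.
(* Both sides have the same sixteen values; with opaque linear factors, only commutativity of the
   product remains. *)
pose L t : {poly S} := 1 + t *: 'X; rewrite -![1 + _ *: 'X]/(L _).
move: L; case: s1 => -> L; rewrite ?mul1r ?mulN1r !(opprD, opprK, mul1r, mulN1r) !addrA; ring.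
Qed.

Definition lawN1_roots x y z :=
  vec4 ((x + y + z) ^+ 2) ((x + y - z) ^+ 2) ((x - y + z) ^+ 2) ((x - y - z) ^+ 2).

(** The values of both sides are the squares of x ± y ± z ± u ± v. Keeping the first sign positive
    in [lawN1_roots] makes the sixteen values match literally. *)
Lemma lawN1_roots_assoc x y z u v :
  \prod_(l < 4) law (-1) 40 (lawN1_roots x y z l) (u ^+ 2) (v ^+ 2)
  = \prod_(l < 4) law (-1) 40 (x ^+ 2) (lawN1_roots y z u l) (v ^+ 2).
Proof.
rewrite !prod4 /lawN1_roots /vec4 !(tnth_nth 0) /= !lawN1_factor.
pose L t : {poly S} := 1 + t ^+ 2 *: 'X; rewrite -![1 + _ ^+ 2 *: 'X]/(L _).
by move: L => L; rewrite !(opprD, opprK) !addrA; ring.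
Qed.
End Associativity.

(** * The axioms for the explicit laws over [R] *)

Section LawFTL.
Variable R : comAlgType Zeps.
Local Notation eps := (eps R).
Local Notation iota F := (map_poly mps_of_mpoly F).

Lemma eps_sqr : eps ^+ 2 = 1.
Proof.
rewrite /Defs.eps exprZn expr1n (_ : Zeps_eps ^+ 2 = 1) ?scale1r //.
apply: Zeps_ev_inj; rewrite rmorphXn rmorph1 /= Zeps_ev_eps.
by apply/eqP; vm_compute.
Qed.

Definition law_mpoly (c : R) : {poly {mpoly R[3]}} :=
  law eps%:MP c%:MP 'X_0 'X_1 'X_2.

Lemma ev3_law (S : comNzRingType) (f : {rmorphism R -> S}) x y z c :
  ev3 f x y z (law_mpoly c) = law (f eps) (f c) x y z.
Proof.
rewrite /ev3 /law_mpoly map_law /= ![mmap _ _ _%:MP]mmapC.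
by congr law; rewrite mmapX mmap1U.
Qed.

Lemma law_coefE (S : comNzRingType) (e c x y z : S) :
  [/\ (law e c x y z)`_0 = 1, (law e c x y z)`_1 = 2 * (1 - e) * (x + y + z),
    (law e c x y z)`_2 = 2 * (1 - 2 * e) * (x ^+ 2 + y ^+ 2 + z ^+ 2)
       + 2 * (1 - e) * (x * y + y * z + x * z),
    (law e c x y z)`_3 = 2 * (1 - e) * (x ^+ 3 + y ^+ 3 + z ^+ 3)
       - 2 * (1 - e) * (x ^+ 2 * (y + z) + y ^+ 2 * (x + z) + z ^+ 2 * (x + y))
       + c * (x * y * z) &
    (law e c x y z)`_4 = x ^+ 4 + y ^+ 4 + z ^+ 4
       - 2 * (1 - e) * (x ^+ 3 * (y + z) + y ^+ 3 * (x + z) + z ^+ 3 * (x + y))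
       + 2 * (1 - 2 * e) * (x ^+ 2 * y ^+ 2 + y ^+ 2 * z ^+ 2 + x ^+ 2 * z ^+ 2)
       + 2 * (1 - e) * (x ^+ 2 * y * z + y ^+ 2 * x * z + z ^+ 2 * x * y)].
Proof.
by rewrite /law !(coefD, coefZ, coef1, coefX, coefXn) /= !(mulr0, mulr1, addr0, add0r).
Qed.

Lemma size_law (S : comNzRingType) (e c x y z : S) : (size (law e c x y z) <= 5)%N.
Proof.
apply/leq_sizeP => i; case: i => [|[|[|[|[|i]]]]] // _.
by rewrite /law !(coefD, coefZ, coef1, coefX, coefXn) /= !(mulr0, addr0).
Qed.

(** Homogeneity yields both the degree bound and the vanishing of the constant terms needed for
    composability. *)
Lemma dhomog_law c l : (l <= 4)%N -> (law_mpoly c)`_l \is l.-homog.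
Proof.
have hM n k d (p q : {mpoly R[3]}) : p \is n.-homog -> q \is k.-homog ->
    (n + k)%N = d -> p * q \is d.-homog.
  by move=> ? ? <-; apply: dhomogM.
have hE n d (p : {mpoly R[3]}) : p \is 1.-homog -> n = d -> p ^+ n \is d.-homog.
  by move=> hp <-; rewrite -[n in n.-homog]mul1n; apply: dhomogMn.
have hX i : ('X_i : {mpoly R[3]}) \is 1.-homog by rewrite dhomogX /= mdeg1.
have hC d k (p : {mpoly R[3]}) : p \is d.-homog -> k%:MP * p \is d.-homog.
  by move=> hp; rewrite mul_mpolyC rpredZ.
have [c0 c1 c2 c3 c4] := law_coefE eps%:MP c%:MP 'X_0 'X_1 ('X_2 : {mpoly R[3]}).
have k1 : 2 * (1 - eps%:MP) = (2 * (1 - eps))%:MP :> {mpoly R[3]}.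
  by rewrite mpolyCM mpolyCB mpolyC1; congr (_ * _); rewrite -mpolyC_nat.
have k2 : 2 * (1 - 2 * eps%:MP) = (2 * (1 - 2 * eps))%:MP :> {mpoly R[3]}.
  by rewrite !(mpolyCM, mpolyCB) mpolyC1; congr (_ * (_ - _ * _)); rewrite -mpolyC_nat.
rewrite k1 k2 in c1 c2 c3 c4.
case: l => [|[|[|[|[|l]]]]] // _; rewrite /law_mpoly ?(c0, c1, c2, c3, c4).
- exact: dhomog1.
- by rewrite hC // !rpredD.
- by rewrite !rpredD // !hC // !rpredD // ?hE // (hM 1%N 1%N).
- apply: rpredD; [apply: rpredB|]; rewrite hC //.
  + by rewrite !rpredD // hE.
  + by rewrite !rpredD // (hM 2%N 1%N) ?rpredD ?hE.
  + by rewrite (hM 2%N 1%N) // (hM 1%N 1%N).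
- apply: rpredD; [apply: rpredD; [apply: rpredB|]|]; rewrite ?hC //.
  + by rewrite !rpredD // hE.
  + by rewrite !rpredD // (hM 3%N 1%N) ?rpredD ?hE.
  + by rewrite !rpredD // (hM 2%N 2%N) ?hE.
  + by rewrite !rpredD // (hM 3%N 1%N) // (hM 2%N 1%N) ?hE.
Qed.

Lemma degree_law c : degree_le (iota (law_mpoly c)) 0.
Proof.
move=> l m /andP[_ l4]; rewrite coef_map /= => nz; rewrite subr_le0 lez_nat.
rewrite leq_eqVlt; apply/orP; left; apply: contraNT nz => nm.
by rewrite -[X in X == _]/(_ @_ m) (dhomog_nemf_coeff (dhomog_law c l4)).
Qed.

Lemma is_series_law c : is_series 4 (iota (law_mpoly c)).
Proof.
split; last by apply: leq_trans (size_poly _ _) (size_law _ _ _ _ _).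
rewrite coef_map /= /law_mpoly.
by have [-> _ _ _ _] := law_coefE eps%:MP c%:MP 'X_0 'X_1 ('X_2 : {mpoly R[3]}); apply: rmorph1.
Qed.

Lemma composable_law c : composable (iota (law_mpoly c)).
Proof.
move=> l l0; rewrite coef_map /=; have [l4|l4] := leqP l 4.
  rewrite -[LHS]/(_ @_ 0%MM) (dhomog_nemf_coeff (dhomog_law c l4)) //= mdeg0 eq_sym.
  by rewrite -lt0n.
by rewrite nth_default ?rmorph0 // (leq_trans (size_law _ _ _ _ _)).
Qed.

Lemma is_FTL_law c : ftl_associativity (iota (law_mpoly c)) -> is_FTL (iota (law_mpoly c)).
Proof.
move=> assoc; have e2 d : (eps%:MP : {mpoly R[d]}) ^+ 2 = 1 by rewrite -rmorphXn eps_sqr.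
split=> //; first exact: is_series_law.
- by apply/ftl_neutral_poly; rewrite ev3_law law_neutral ?e2 // mul_mpolyC.
- apply/ftl_symmetry_poly => s; rewrite map_law /= /msym !mmapC !mmapX !mmap1U.
  exact: (law_perm _ _ (fun i => 'X_i)).
- apply/ftl_linearity_poly; rewrite ev3_law -mul_mpolyC mpolyCN.
  by rewrite law_linear ?e2.
- by apply/ftl_weak_neutral_poly; rewrite ev3_law law_weak ?e2.
Qed.

(** Substituting squares doubles exponents and loses no coefficient, so a polynomial identity may be
    checked at squares of the variables. *)
Lemma mcoeff_mmapX2 d (S : comNzRingType) (f : {rmorphism R -> S}) (p : {mpoly R[d]}) m :
  (mmap (@mpolyC d S \o f) (fun i => 'X_i ^+ 2) p)@_(m *+ 2) = f p@_m.
Proof.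
rewrite [in LHS]/mmap raddf_sum /=.
have E k : (mmap1 (fun i => 'X_i ^+ 2 : {mpoly S[d]}) k)@_(m *+ 2) = (k == m)%:R.
  rewrite /mmap1; under eq_bigr do rewrite -exprM mulnC exprM.
  rewrite prodrXl -mpolyXE_id mpolyXn mcoeffX; congr (nat_of_bool _)%:R.
  apply/idP/idP => [/eqP/mnmP h|/eqP -> //]; apply/eqP/mnmP => i; have := h i.
  by rewrite !mulmnE !mulnS !muln0 !addn0 !addnn => /double_inj.
under eq_bigr do rewrite mcoeffCM E.
have [mp|mp] := boolP (m \in msupp p).
  rewrite (bigD1_seq m) //= eqxx mulr1 big1 ?addr0 // => k /negPf ->.
  by rewrite mulr0.
rewrite (memN_msupp_eq0 mp) rmorph0 big_seq big1 // => k kp.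
by case: eqP => [ek|]; rewrite ?mulr0 //; move: mp; rewrite -ek kp.
Qed.

Lemma mcoeff_map_mmap d (S : comNzRingType) (f : {rmorphism R -> S}) (v w : 'I_d -> S)
    (H H' : {poly {mpoly R[d]}}) i :
  map_poly (mmap f v) H = map_poly (mmap f v) H' -> v =1 w -> mmap f w H`_i = mmap f w H'`_i.
Proof.
move=> /polyP/(_ i); rewrite !coef_map /= => HH' vw.
by rewrite -!(eq_mmap (fun=> erefl) vw).
Qed.

Lemma law_assoc_pos c (S : comNzRingType) (h : {rmorphism R -> S}) s x y z u v :
    h eps = 1 -> h c = 8 * s -> s = 1 \/ s = -1 ->
  exists r r' : 'I_4 -> S,
    [/\ ev3 h x y z (law_mpoly c) = \prod_(l < 4) (1 + r l *: 'X),
      ev3 h y z u (law_mpoly c) = \prod_(l < 4) (1 + r' l *: 'X)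
    & \prod_(l < 4) ev3 h (r l) u v (law_mpoly c) = \prod_(l < 4) ev3 h x (r' l) v (law_mpoly c)].
Proof.
move=> e1 c1 s1.
have split a b d : ev3 h a b d (law_mpoly c) = \prod_(l < 4) (1 + law1_roots s a b d l *: 'X).
  by rewrite ev3_law e1 c1 law1_factor // prod4 /law1_roots /vec4 !(tnth_nth 0).
exists (law1_roots s x y z), (law1_roots s y z u); split=> //.
under eq_bigr do rewrite ev3_law e1 c1.
by under [RHS]eq_bigr do rewrite ev3_law e1 c1; apply: law1_roots_assoc.
Qed.

(** The factorization for eps = -1 has values polynomial in square roots of the arguments, so the
    arguments are taken to be squares. *)
Lemma law_assoc_neg c (S : comNzRingType) (h : {rmorphism R -> S}) x y z u v :
    h eps = -1 -> h c = 40 ->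
  exists r r' : 'I_4 -> S,
    [/\ ev3 h (x ^+ 2) (y ^+ 2) (z ^+ 2) (law_mpoly c) = \prod_(l < 4) (1 + r l *: 'X),
      ev3 h (y ^+ 2) (z ^+ 2) (u ^+ 2) (law_mpoly c) = \prod_(l < 4) (1 + r' l *: 'X)
    & \prod_(l < 4) ev3 h (r l) (u ^+ 2) (v ^+ 2) (law_mpoly c)
      = \prod_(l < 4) ev3 h (x ^+ 2) (r' l) (v ^+ 2) (law_mpoly c)].
Proof.
move=> e1 c1.
have split a b d : ev3 h (a ^+ 2) (b ^+ 2) (d ^+ 2) (law_mpoly c)
    = \prod_(l < 4) (1 + lawN1_roots a b d l *: 'X).
  by rewrite ev3_law e1 c1 lawN1_factor // prod4 /lawN1_roots /vec4 !(tnth_nth 0).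
exists (lawN1_roots x y z), (lawN1_roots y z u); split=> //.
under eq_bigr do rewrite ev3_law e1 c1.
by under [RHS]eq_bigr do rewrite ev3_law e1 c1; apply: lawN1_roots_assoc.
Qed.

(** Coefficients are compared on the two factors of Q x Q. On the first, both sides are evaluated at
    the variables of Q[x_0, ..., x_4], where the inner laws split. *)
Lemma law_associativity c (f : {rmorphism R -> (rat * rat)%type}) s :
    injective f -> f eps = (1, -1) -> s = 1 \/ s = -1 -> f c = (8 * s, 40) ->
  ftl_associativity (iota (law_mpoly c)).
Proof.
move=> f_inj f_eps s1 fc.
have [H1 [H2 [assocE H1E H2E]]] := ftl_associativity_poly (is_series_law c) (composable_law c).
apply/assocE/polyP => i; apply/mpolyP => m.
pose fst' : {rmorphism (rat * rat)%type -> rat} := fst.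
pose snd' : {rmorphism (rat * rat)%type -> rat} := snd.
pose x j : {mpoly rat[5]} := 'X_j.
apply: (eq_from_pair f_inj).
  pose f1 : {rmorphism R -> {mpoly rat[5]}} := @mpolyC 5 rat \o (fst' \o f).
  have e1 : f1 eps = 1 by rewrite /f1 /= f_eps mpolyC1.
  have c1 : f1 c = 8 * s%:MP by rewrite /f1 /= fc /= mpolyCM; congr (_ * _); rewrite -mpolyC_nat.
  have s1' : s%:MP = 1 :> {mpoly rat[5]} \/ s%:MP = -1 :> {mpoly rat[5]}.
    by case: s1 => ->; [left|right]; rewrite ?mpolyCN mpolyC1.
  have [r [r' [rE r'E h]]] := law_assoc_pos (x 0) (x 1) (x 2) (x 3) (x 4) e1 c1 s1'.
  have {rE r'E}h := etrans (H1E _ _ _ _ _ _ _ _ rE) (etrans h (esym (H2E _ _ _ _ _ _ _ _ r'E))).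
  have X5 k : vec5 (x 0) (x 1) (x 2) (x 3) (x 4) k = 'X_k.
    by case: k => [[|[|[|[|[|]]]]]] // p; congr ('X__); apply: val_inj.
  have := congr1 (mcoeff m) (mcoeff_map_mmap i h X5).
  by rewrite -!/(map_mpoly (fst' \o f) _) !mcoeff_map_mpoly.
(* On the second factor the evaluation is at the squares of the variables, and [mcoeff_mmapX2]
   recovers the coefficients. *)
pose f1 : {rmorphism R -> {mpoly rat[5]}} := @mpolyC 5 rat \o (snd' \o f).
have e1 : f1 eps = -1 by rewrite /f1 /= f_eps mpolyCN mpolyC1.
have c1 : f1 c = 40 by rewrite /f1 /= fc /= -mpolyC_nat.
have [r [r' [rE r'E h]]] := law_assoc_neg (x 0) (x 1) (x 2) (x 3) (x 4) e1 c1.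
have {rE r'E}h := etrans (H1E _ _ _ _ _ _ _ _ rE) (etrans h (esym (H2E _ _ _ _ _ _ _ _ r'E))).
have X5 k : vec5 (x 0 ^+ 2) (x 1 ^+ 2) (x 2 ^+ 2) (x 3 ^+ 2) (x 4 ^+ 2) k = 'X_k ^+ 2.
  by case: k => [[|[|[|[|[|]]]]]] // p; congr ('X__ ^+ 2); apply: val_inj.
have := congr1 (mcoeff (m *+ 2)) (mcoeff_map_mmap i h X5).
by rewrite !(mcoeff_mmapX2 (snd' \o f)).
Qed.

End LawFTL.

(** * Power sums of the values *)

Section Newton.
Variable S : comNzRingType.
Implicit Types (p q : {poly S}) (b d r v : S).

(** Newton's identities: for p = prod (1 + r_l t), [newton1] to [newton4] are the power sums of the
    r_l of exponents 1 to 4. *)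
Definition newton1 p := p`_1.
Definition newton2 p := p`_1 ^+ 2 - 2 * p`_2.
Definition newton3 p := p`_1 ^+ 3 - 3 * p`_1 * p`_2 + 3 * p`_3.
Definition newton4 p :=
  p`_1 ^+ 4 - 4 * p`_1 ^+ 2 * p`_2 + 2 * p`_2 ^+ 2 + 4 * p`_1 * p`_3 - 4 * p`_4.

(** Additivity of power sums, proved on coefficients, so that neither factor has to split. *)
Lemma newtonM p q : p`_0 = 1 -> q`_0 = 1 ->
  [/\ (p * q)`_0 = 1, newton1 (p * q) = newton1 p + newton1 q,
    newton2 (p * q) = newton2 p + newton2 q, newton3 (p * q) = newton3 p + newton3 q
  & newton4 (p * q) = newton4 p + newton4 q].
Proof.
move=> p0 q0; rewrite /newton1 /newton2 /newton3 /newton4.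
rewrite !coefM !big_ord_recl !big_ord0 /= /bump /= !subn0 ?add1n ?subn1 ?subSS ?subn0 /= p0 q0.
by split; ring.
Qed.

Lemma newton_prod4 (P : 'I_4 -> {poly S}) : (forall l, (P l)`_0 = 1) ->
  [/\ newton1 (\prod_(l < 4) P l) = newton1 (P 0) + newton1 (P 1) + newton1 (P 2) + newton1 (P 3),
    newton2 (\prod_(l < 4) P l) = newton2 (P 0) + newton2 (P 1) + newton2 (P 2) + newton2 (P 3),
    newton3 (\prod_(l < 4) P l) = newton3 (P 0) + newton3 (P 1) + newton3 (P 2) + newton3 (P 3)
  & newton4 (\prod_(l < 4) P l) = newton4 (P 0) + newton4 (P 1) + newton4 (P 2) + newton4 (P 3)].
Proof.
move=> P0; rewrite prod4.
have [c01 a1 a2 a3 a4] := newtonM (P0 0) (P0 1).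
have [c012 b1 b2 b3 b4] := newtonM c01 (P0 2).
have [_ -> -> -> ->] := newtonM c012 (P0 3).
by rewrite b1 b2 b3 b4 a1 a2 a3 a4.
Qed.

Definition quartic c1 c2 c3 c4 : {poly S} :=
  1 + c1 *: 'X + c2 *: 'X^2 + c3 *: 'X^3 + c4 *: 'X^4.

Lemma quartic0 c1 c2 c3 c4 : (quartic c1 c2 c3 c4)`_0 = 1.
Proof.
by rewrite /quartic !(coefD, coefZ, coef1, coefX, coefXn) /= !(mulr0, mulr1, addr0, add0r).
Qed.

Lemma quartic1 c1 c2 c3 c4 : (quartic c1 c2 c3 c4)`_1 = c1.
Proof.
by rewrite /quartic !(coefD, coefZ, coef1, coefX, coefXn) /= !(mulr0, mulr1, addr0, add0r).
Qed.

Lemma quartic2 c1 c2 c3 c4 : (quartic c1 c2 c3 c4)`_2 = c2.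
Proof.
by rewrite /quartic !(coefD, coefZ, coef1, coefX, coefXn) /= !(mulr0, mulr1, addr0, add0r).
Qed.

Lemma quartic3 c1 c2 c3 c4 : (quartic c1 c2 c3 c4)`_3 = c3.
Proof.
by rewrite /quartic !(coefD, coefZ, coef1, coefX, coefXn) /= !(mulr0, mulr1, addr0, add0r).
Qed.

Lemma quartic4 c1 c2 c3 c4 : (quartic c1 c2 c3 c4)`_4 = c4.
Proof.
by rewrite /quartic !(coefD, coefZ, coef1, coefX, coefXn) /= !(mulr0, mulr1, addr0, add0r).
Qed.

Lemma newton_linear r :
  [/\ (1 + r *: 'X : {poly S})`_0 = 1, newton1 (1 + r *: 'X) = r, newton2 (1 + r *: 'X) = r ^+ 2,
    newton3 (1 + r *: 'X) = r ^+ 3 & newton4 (1 + r *: 'X) = r ^+ 4].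
Proof.
rewrite /newton1 /newton2 /newton3 /newton4 !(coefD, coefZ, coef1, coefX) /=.
by rewrite !(mulr0, mulr1, addr0, add0r); split; ring.
Qed.

(* The laws satisfying all the linear relations for eps = -1; b and d are the
   deviations of the coefficients of xy t^2 and x^2y t^3 from the additive law. *)
Definition candidate b d (x y z : S) : {poly S} :=
  quartic (4 * (x + y + z))
    (6 * (x ^+ 2 + y ^+ 2 + z ^+ 2) + (4 + b) * (x * y + y * z + x * z))
    (4 * (x ^+ 3 + y ^+ 3 + z ^+ 3)
      + (d - 4) * (x ^+ 2 * (y + z) + y ^+ 2 * (x + z) + z ^+ 2 * (x + y))
      + (40 + 6 * b - 6 * d) * (x * y * z))
    (x ^+ 4 + y ^+ 4 + z ^+ 4
      + (d - b - 4) * (x ^+ 3 * (y + z) + y ^+ 3 * (x + z) + z ^+ 3 * (x + y))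
      + (6 + 2 * b - 2 * d) * (x ^+ 2 * y ^+ 2 + y ^+ 2 * z ^+ 2 + x ^+ 2 * z ^+ 2)
      + (4 + b) * (x ^+ 2 * y * z + y ^+ 2 * x * z + z ^+ 2 * x * y)).

(** The [r l] are the values of 1 * 1, and the values of all [r l] * v are those of 1 * 1 * v, four
    times each. The power sums of r * v are polynomials in r, so their sum over l needs only the
    power sums of the [r l], read off the coefficients of [candidate b d 1 0 1]. Exponent 3 gives
    the first relation, exponent 4 the second. *)
Lemma candidate_newton b d v (r : 'I_4 -> S) :
    candidate b d 1 0 1 = \prod_(l < 4) (1 + r l *: 'X) ->
    \prod_(l < 4) candidate b d (r l) 0 v = candidate b d 1 1 v ^+ 4 ->
  6 * v * (4 * b ^+ 2 - b * d - 56 * b + 24 * d) = 0 /\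
  4 * v * (v * (- b ^+ 3 + 68 * b ^+ 2 - 20 * b * d - 688 * b + 304 * d)
       + 2 * (104 * b ^+ 2 - 63 * b * d - 704 * b + 9 * d ^+ 2 + 328 * d)) = 0.
Proof.
move=> splitE assocE.
pose P l := 1 + r l *: 'X : {poly S}.
have P0 l : (P l)`_0 = 1 by have [] := newton_linear (r l).
have := newton_prod4 P0; rewrite -splitE.
have n1 l : newton1 (P l) = r l by have [] := newton_linear (r l).
have n2 l : newton2 (P l) = r l ^+ 2 by have [] := newton_linear (r l).
have n3 l : newton3 (P l) = r l ^+ 3 by have [] := newton_linear (r l).
have n4 l : newton4 (P l) = r l ^+ 4 by have [] := newton_linear (r l).
rewrite !n1 !n2 !n3 !n4 => -[s1 s2 s3 s4].
have Q0 x y z : (candidate b d x y z)`_0 = 1.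
  exact: quartic0.
have [_ _ t3 t4] := newton_prod4 (fun l => Q0 (r l) 0 v).
have cand4 : candidate b d 1 1 v ^+ 4 = \prod_(l < 4) candidate b d 1 1 v.
  by rewrite prodr_const card_ord.
have [_ _ w3 w4] := newton_prod4 (fun _ : 'I_4 => Q0 1 1 v).
move: t3 t4; rewrite assocE cand4 w3 w4 => {w3 w4 assocE cand4 splitE}.
move: s1 s2 s3 s4; rewrite /newton1 /newton2 /newton3 /newton4 /candidate.
rewrite !quartic1 !quartic2 !quartic3 !quartic4.
move: (r 0) (r 1) (r 2) (r 3) => r0 r1 r2 r3 s1 s2 s3 s4 t3 t4.
(* X = Y will be the equation of power sums, and the multiples of G_i - T_i eliminate the i-th power
   sums of the r's. *)
have comb X Y G1 T1 G2 T2 G3 T3 G4 T4 a1 a2 a3 a4 (g : S) : X = Y ->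
    G1 = T1 -> G2 = T2 -> G3 = T3 -> G4 = T4 ->
    g = X - Y + a1 * (G1 - T1) + a2 * (G2 - T2) + a3 * (G3 - T3) + a4 * (G4 - T4) -> g = 0.
  by move=> -> -> -> -> -> ->; rewrite !subrr !mulr0 !addr0.
(* The third power sum of the values of r * v is 4 r^3 + 4 v^3 + A (r^2 v + r v^2),
   the fourth 4 r^4 + 4 v^4 + C (r^3 v + r v^3) + D r^2 v^2. *)
pose A := 60 - 12 * b + 3 * d; pose C := 112 - 36 * b + 12 * d.
pose D := 280 - 120 * b + 40 * d + 2 * b ^+ 2.
split.
  by apply: (comb _ _ _ _ _ _ _ _ _ _ (A * v ^+ 2) (A * v) 4 0 _ (esym t3) s1 s2 s3 s4);
    rewrite /A; ring.
by apply: (comb _ _ _ _ _ _ _ _ _ _ (C * v ^+ 3) (D * v ^+ 2) (C * v) 4 _ (esym t4) s1 s2 s3 s4);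
  rewrite /C /D; ring.
Qed.
End Newton.

Lemma split_quartic (P : {poly algC}) : P`_0 = 1 -> (size P <= 5)%N ->
  exists r : 'I_4 -> algC, P = \prod_(l < 4) (1 + r l *: 'X).
Proof.
(* The reversed polynomial t^4 P(1/t) is monic because P(0) = 1. It has exactly four roots even if P
   has lower degree; the missing values are then 0. *)
move=> P0 sP; pose q : {poly algC} := 'X^4 + \poly_(i < 4) P`_(4 - i).
have sq : size q = 5%N by rewrite size_polyDl size_polyXn // ltnS size_poly.
have lq : lead_coef q = 1 by rewrite lead_coefDl ?lead_coefXn // size_polyXn ltnS size_poly.
have [rs qE] := closed_field_poly_normal q.
move: qE; rewrite lq scale1r => qE.
have srs : size rs = 4 by apply: succn_inj; rewrite -sq qE size_prod_XsubC.
case: rs srs qE => [|z0 [|z1 [|z2 [|z3 []]]]] // _ qE.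
exists (vec4 (- z0) (- z1) (- z2) (- z3)).
rewrite prod4 /vec4 !(tnth_nth 0) /=.
have cE i : q`_i = (i == 4)%:R + (if (i < 4)%N then P`_(4 - i) else 0).
  by rewrite coefD coefXn coef_poly.
move: cE; rewrite qE !big_cons big_nil mulr1 => cE.
have exp : ('X - z0%:P) * (('X - z1%:P) * (('X - z2%:P) * ('X - z3%:P)))
   = 'X^4 + (- (z0 + z1 + z2 + z3)) *: 'X^3
     + (z0 * z1 + z0 * z2 + z0 * z3 + z1 * z2 + z1 * z3 + z2 * z3) *: 'X^2
     + (- (z0 * z1 * z2 + z0 * z1 * z3 + z0 * z2 * z3 + z1 * z2 * z3)) *: 'X
     + (z0 * z1 * z2 * z3)%:P by rewrite -!mul_polyC; ring.
rewrite exp in cE.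
have c i := cE i; move: (c 0) (c 1) (c 2) (c 3).
rewrite !(coefD, coefZ, coefC, coefX, coefXn) /= !(mulr0, mulr1, addr0, add0r) => c4 c3 c2 c1.
have -> : P = quartic P`_1 P`_2 P`_3 P`_4.
  apply/polyP => i; rewrite /quartic !(coefD, coefZ, coef1, coefX, coefXn).
  case: i => [|[|[|[|[|i]]]]] /=; rewrite ?P0 !(mulr0, mulr1, addr0, add0r) //.
  by rewrite nth_default // (leq_trans sP).
rewrite -c1 -c2 -c3 -c4 /quartic -!mul_polyC; ring.
Qed.

(** * Symmetric polynomials of degree at most 4 in three variables *)

Definition mnm3 (s : seq nat) : 'X_{1..3} := [multinom nth 0%N s i | i < 3].

Lemma mnm3K (m : 'X_{1..3}) : mnm3 m = m.
Proof. by apply/mnmP => i; rewrite mnmE /= -tnth_nth. Qed.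

Lemma msym_mnm3 (R : comNzRingType) (p : {mpoly R[3]}) (m : 'X_{1..3}) s :
  p \is symmetric -> perm_eq m s -> p@_(mnm3 s) = p@_m.
Proof.
move=> psym; rewrite perm_sym => /tuple_permP [t ->].
rewrite -(msym_coeff m t psym); congr (_ @_ _).
by apply/mnmP => i; rewrite !mnmE -[nth _ _ _]/(nth 0%N (tval _) i) -tnth_nth tnth_mktuple.
Qed.

(** The exponent types of degree at most 4 in three variables, one for each orbit of monomials. *)
Definition partitions4 : seq (seq nat) :=
  [:: [:: 0; 0; 0]; [:: 1; 0; 0]; [:: 2; 0; 0]; [:: 1; 1; 0]; [:: 3; 0; 0]; [:: 2; 1; 0];
      [:: 1; 1; 1]; [:: 4; 0; 0]; [:: 3; 1; 0]; [:: 2; 2; 0]; [:: 2; 1; 1]]%N.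

Lemma partitions4_count a b c : (a + b + c < 5)%N ->
  count (perm_eq [:: a; b; c]) partitions4 = 1%N.
Proof.
have : all (fun a => all (fun b => all (fun c => (a + b + c < 5)%N ==>
  (count (perm_eq [:: a; b; c]) partitions4 == 1%N)) (iota 0 5)) (iota 0 5)) (iota 0 5).
  by vm_compute.
move=> /allP h abc5.
have lt5 n : (n <= a + b + c)%N -> n \in iota 0 5.
  by rewrite mem_iota => le_n; apply: leq_ltn_trans le_n abc5.
have /h/allP hb : a \in iota 0 5 by apply: lt5; rewrite -addnA leq_addr.
have /hb/allP hc : b \in iota 0 5 by apply: lt5; rewrite addnAC leq_addl.
have /hc : c \in iota 0 5 by apply: lt5; rewrite leq_addl.
by rewrite abc5 => /eqP.
Qed.

(** Each monomial of degree at most 4 occurs in exactly one of the orbit sums, and [p] has a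
    constant coefficient along each orbit. *)
Lemma symmetric_decomposition (R : comNzRingType) (p : {mpoly R[3]}) :
    p \is symmetric -> (msize p <= 5)%N ->
  p = \sum_(s <- partitions4) p@_(mnm3 s) *: \sum_(t <- permutations s) 'X_[mnm3 t].
Proof.
move=> psym sp; apply/mpolyP => m; rewrite raddf_sum /=.
have coefE s : s \in partitions4 ->
    (p@_(mnm3 s) *: \sum_(t <- permutations s) 'X_[mnm3 t])@_m = p@_m * (perm_eq m s)%:R.
  move=> /(allP (isT : all (fun s => size s == 3%N) partitions4))/eqP s3.
  rewrite mcoeffZ raddf_sum /= -mem_permutations -sum_eq_mem ?permutations_uniq //.
  rewrite [in LHS]big_seq [in RHS]big_seq !mulr_sumr; apply: eq_bigr => t.
  rewrite mem_permutations => ts; rewrite mcoeffX.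
  have t3 : size t == 3%N by rewrite (perm_size ts) s3.
  have -> : (mnm3 t == m) = (t == m).
    apply/eqP/eqP => [<-|->]; last exact: mnm3K.
    by have /(congr1 (fun k : 'X_{1..3} => k : seq nat)) := mnm3K (Multinom (Tuple t3)).
  by case: eqP => [tm|]; rewrite ?mulr0 //; congr (_ * _); apply: msym_mnm3; rewrite // -tm.
rewrite big_seq; under eq_bigr => s sP do rewrite coefE //.
rewrite -big_seq -mulr_sumr.
have [lt5|ge5] := ltnP (mdeg m) 5; last first.
  rewrite [p@_m]memN_msupp_eq0 ?mul0r //; apply: contraL ge5 => /msize_mdeg_lt.
  by rewrite -ltnNge => /leq_trans; apply.
rewrite -natr_sum [X in _ = _ * X%:R](_ : _ = count (perm_eq m) partitions4); last first.
  by elim: partitions4 => [|s r IH]; rewrite ?big_nil // big_cons IH.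
suff -> : count (perm_eq m) partitions4 = 1%N by rewrite mulr1.
move: lt5; rewrite mdegE !big_ord_recl big_ord0 addn0 addnA => lt5.
apply: etrans (partitions4_count lt5); apply: eq_count => s; congr (perm_eq _ s).
by case: m {lt5 coefE} => -[[|a [|b [|c []]]] i] //=; rewrite !multinomE !(tnth_nth 0%N).
Qed.

(* The value at (x, y, z) of the symmetric polynomial of degree at most 4 whose
   coefficient at the monomials of exponent type (i, j, k) is a i j k. *)
Definition sym_value (S : comNzRingType) (a : nat -> nat -> nat -> S) (x y z : S) : S :=
  a 0 0 0 + a 1 0 0 * (x + y + z) + a 2 0 0 * (x ^+ 2 + y ^+ 2 + z ^+ 2)
  + a 1 1 0 * (x * y + y * z + x * z)
  + a 3 0 0 * (x ^+ 3 + y ^+ 3 + z ^+ 3)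
  + a 2 1 0 * (x ^+ 2 * (y + z) + y ^+ 2 * (x + z) + z ^+ 2 * (x + y))
  + a 1 1 1 * (x * y * z)
  + a 4 0 0 * (x ^+ 4 + y ^+ 4 + z ^+ 4)
  + a 3 1 0 * (x ^+ 3 * (y + z) + y ^+ 3 * (x + z) + z ^+ 3 * (x + y))
  + a 2 2 0 * (x ^+ 2 * y ^+ 2 + y ^+ 2 * z ^+ 2 + x ^+ 2 * z ^+ 2)
  + a 2 1 1 * (x ^+ 2 * y * z + y ^+ 2 * x * z + z ^+ 2 * x * y).

Lemma mmap_symmetric (R S : comNzRingType) (h : {rmorphism R -> S}) (p : {mpoly R[3]}) x y z :
    p \is symmetric -> (msize p <= 5)%N ->
  mmap h (vec3 x y z) p = sym_value (fun i j k => h p@_(mnm3 [:: i; j; k])) x y z.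
Proof.
move=> psym sp; rewrite [in LHS](symmetric_decomposition psym sp) raddf_sum /=.
pose A s := h p@_(mnm3 s).
transitivity (\sum_(s <- partitions4) A s * monomial_sum x y z s).
  apply: eq_bigr => s _; rewrite mmapZ raddf_sum /=; congr (_ * _); apply: eq_bigr => t _.
  by rewrite mmapX /mmap1 !big_ord_recl big_ord0 !mnmE mulr1 mulrA.
rewrite -[RHS]/(sym_value (fun i j k => A [:: i; j; k]) x y z); move: A => A.
by rewrite /partitions4 !big_cons big_nil !monomial_sumE /sym_value mulr1 addr0 !addrA.
Qed.

(** * Uniqueness *)

Lemma coef_comp_scaleX (S : comNzRingType) (p : {poly S}) c l :
  (p \Po (c *: 'X))`_l = p`_l * c ^+ l.
Proof.
rewrite comp_polyE coef_sum; under eq_bigr do rewrite exprZn !coefZ coefXn.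
have [lt_l|ge_l] := ltnP l (size p); last first.
  rewrite nth_default // mul0r big1 // => i _; case: eqP => [li|]; rewrite ?mulr0 //.
  by move: (ltn_ord i); rewrite -li ltnNge ge_l.
rewrite (bigD1 (Ordinal lt_l)) //= eqxx mulr1 big1 ?addr0 // => i ne.
by case: eqP => [li|]; rewrite ?mulr0 //; case/eqP: ne; apply: val_inj.
Qed.

Section SymmetricValueTheory.
Variables (S : comNzRingType) (a : nat -> nat -> nat -> S).

Lemma sym_valueC x y z : sym_value a x y z = sym_value a y x z.
Proof. by rewrite /sym_value; ring. Qed.

Lemma sym_valueAC x y z : sym_value a x y z = sym_value a x z y.
Proof. by rewrite /sym_value; ring. Qed.

Lemma sym_value0 : sym_value a 0 0 0 = a 0%N 0%N 0%N.
Proof. by rewrite /sym_value; ring. Qed.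

End SymmetricValueTheory.

Section SymmetricValues.
Variables (A : nat -> nat -> nat -> rat) (u : rat).

(** Only pure powers survive at (t, 0, 0), where the neutral axiom prescribes the value; a few
    values of t determine their coefficients. The next three lemmas use the same argument. *)
Lemma sym_value1 x y z : (forall i j k, (1 < i + j + k)%N -> A i j k = 0) ->
  (forall t, sym_value A t 0 0 = u * t) -> sym_value A x y z = u * (x + y + z).
Proof.
move=> A0 N; move: (N 0) (N 1); rewrite /sym_value.
rewrite (A0 2 0 0)%N // (A0 1 1 0)%N // (A0 3 0 0)%N // (A0 2 1 0)%N // (A0 1 1 1)%N //.
rewrite (A0 4 0 0)%N // (A0 3 1 0)%N // (A0 2 2 0)%N // (A0 2 1 1)%N //.
move: (A 0 0 0)%N (A 1 0 0)%N => a0 a1 n0 n1.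
have -> : a0 = 0 by lra.
have -> : a1 = u by lra.
by ring.
Qed.

Lemma sym_value2 : (forall i j k, (2 < i + j + k)%N -> A i j k = 0) ->
  (forall t, sym_value A t 0 0 = u * t ^+ 2) ->
  exists b, forall x y z,
    sym_value A x y z = u * (x ^+ 2 + y ^+ 2 + z ^+ 2) + b * (x * y + y * z + x * z).
Proof.
move=> A0 N; exists (A 1 1 0)%N => x y z; move: (N 0) (N 1) (N (-1)); rewrite /sym_value.
rewrite (A0 3 0 0)%N // (A0 2 1 0)%N // (A0 1 1 1)%N //.
rewrite (A0 4 0 0)%N // (A0 3 1 0)%N // (A0 2 2 0)%N // (A0 2 1 1)%N //.
move: (A 0 0 0)%N (A 1 0 0)%N (A 2 0 0)%N (A 1 1 0)%N => a0 a1 a2 b n0 n1 n2.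
have -> : a0 = 0 by lra.
have -> : a1 = 0 by lra.
have -> : a2 = u by lra.
by ring.
Qed.

(** Degree at most 0 still allows inhomogeneous terms: [f] here, and [f1], [f2], [f3] in
    [sym_value4], are their coefficients, to be eliminated by the other axioms. *)
Lemma sym_value3 : (forall i j k, (3 < i + j + k)%N -> A i j k = 0) ->
  (forall t, sym_value A t 0 0 = u * t ^+ 3) ->
  exists d c f, forall x y z,
    sym_value A x y z = u * (x ^+ 3 + y ^+ 3 + z ^+ 3)
    + d * (x ^+ 2 * (y + z) + y ^+ 2 * (x + z) + z ^+ 2 * (x + y))
    + c * (x * y * z) + f * (x * y + y * z + x * z).
Proof.
move=> A0 N; exists (A 2 1 0)%N, (A 1 1 1)%N, (A 1 1 0)%N => x y z.
move: (N 0) (N 1) (N (-1)) (N 2); rewrite /sym_value.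
rewrite (A0 4 0 0)%N // (A0 3 1 0)%N // (A0 2 2 0)%N // (A0 2 1 1)%N //.
move: (A 0 0 0)%N (A 1 0 0)%N (A 2 0 0)%N (A 3 0 0)%N (A 1 1 0)%N (A 2 1 0)%N (A 1 1 1)%N.
move=> a0 a1 a2 a3 f d c n0 n1 nN1 n2.
have -> : a0 = 0 by lra.
have -> : a1 = 0 by lra.
have -> : a2 = 0 by lra.
have -> : a3 = u by lra.
by ring.
Qed.

Lemma sym_value4 : (forall t, sym_value A t 0 0 = t ^+ 4) ->
  exists k1 k2 k3 f1 f2 f3, forall x y z,
    sym_value A x y z = x ^+ 4 + y ^+ 4 + z ^+ 4
    + k1 * (x ^+ 3 * (y + z) + y ^+ 3 * (x + z) + z ^+ 3 * (x + y))
    + k2 * (x ^+ 2 * y ^+ 2 + y ^+ 2 * z ^+ 2 + x ^+ 2 * z ^+ 2)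
    + k3 * (x ^+ 2 * y * z + y ^+ 2 * x * z + z ^+ 2 * x * y)
    + f1 * (x * y + y * z + x * z)
    + f2 * (x ^+ 2 * (y + z) + y ^+ 2 * (x + z) + z ^+ 2 * (x + y))
    + f3 * (x * y * z).
Proof.
move=> N; exists (A 3 1 0)%N, (A 2 2 0)%N, (A 2 1 1)%N, (A 1 1 0)%N, (A 2 1 0)%N, (A 1 1 1)%N.
move=> x y z; move: (N 0) (N 1) (N (-1)) (N 2) (N (-2)); rewrite /sym_value.
move: (A 0 0 0)%N (A 1 0 0)%N (A 2 0 0)%N (A 3 0 0)%N (A 4 0 0)%N => a0 a1 a2 a3 a4.
move: (A 1 1 0)%N (A 2 1 0)%N (A 1 1 1)%N (A 3 1 0)%N (A 2 2 0)%N (A 2 1 1)%N.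
move=> f1 f2 f3 k1 k2 k3 n0 n1 nN1 n2 nN2.
have -> : a0 = 0 by lra.
have -> : a1 = 0 by lra.
have -> : a2 = 0 by lra.
have -> : a3 = 0 by lra.
have -> : a4 = 1 by lra.
by ring.
Qed.

End SymmetricValues.

(** Interpolation: the values at eleven rational points determine the eleven coefficients, so the
    equality persists over every ring. *)
Lemma sym_value_transfer (A B : nat -> nat -> nat -> rat) :
    (forall x y z, sym_value A x y z = sym_value B x y z) ->
  forall (S : comNzRingType) (j : {rmorphism rat -> S}) x y z,
    sym_value (fun i k l => j (A i k l)) x y z = sym_value (fun i k l => j (B i k l)) x y z.
Proof.
move=> AB S j x y z; rewrite /sym_value.
move: (AB 0 0 0) (AB 1 0 0) (AB (-1) 0 0) (AB 2 0 0) (AB (-2) 0 0).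
move: (AB 1 1 0) (AB 1 (-1) 0) (AB 1 2 0) (AB 2 2 0) (AB 1 1 1) (AB 1 1 (-1)).
rewrite /sym_value.
move: (A 0 0 0)%N (A 1 0 0)%N (A 2 0 0)%N (A 3 0 0)%N (A 4 0 0)%N => a0 a1 a2 a3 a4.
move: (B 0 0 0)%N (B 1 0 0)%N (B 2 0 0)%N (B 3 0 0)%N (B 4 0 0)%N => b0 b1 b2 b3 b4.
move: (A 1 1 0)%N (A 2 1 0)%N (A 1 1 1)%N (A 3 1 0)%N (A 2 2 0)%N (A 2 1 1)%N => c1 c2 c3 c4 c5 c6.
move: (B 1 1 0)%N (B 2 1 0)%N (B 1 1 1)%N (B 3 1 0)%N (B 2 2 0)%N (B 2 1 1)%N => d1 d2 d3 d4 d5 d6.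
move=> e1 e2 e3 e4 e5 e6 e7 e8 e9 e10 e11.
have -> : a0 = b0 by lra.
have -> : a1 = b1 by lra.
have -> : a2 = b2 by lra.
have -> : a3 = b3 by lra.
have -> : a4 = b4 by lra.
have -> : c1 = d1 by lra.
have -> : c2 = d2 by lra.
have -> : c3 = d3 by lra.
have -> : c4 = d4 by lra.
have -> : c5 = d5 by lra.
by have -> : c6 = d6 by lra.
Qed.

Lemma law1_horner1 (S : comNzRingType) (c x y z : S) : (law 1 c x y z).[1]
  = 1 - 2 * (x ^+ 2 + y ^+ 2 + z ^+ 2) + c * (x * y * z) + (x ^+ 4 + y ^+ 4 + z ^+ 4)
    - 2 * (x ^+ 2 * y ^+ 2 + y ^+ 2 * z ^+ 2 + x ^+ 2 * z ^+ 2).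
Proof.
by rewrite /law !(hornerD, hornerZ, hornerXn, hornerX, hornerC) ?expr1n; ring.
Qed.

Definition law_coef (S : comNzRingType) (e c : S) (l i j k : nat) : S :=
  match l, i, j, k with
  | 1, 1, 0, 0 | 2, 1, 1, 0 | 3, 3, 0, 0 | 4, 2, 1, 1 => (2 * (1 - e))%R
  | 2, 2, 0, 0 | 4, 2, 2, 0 => (2 * (1 - 2 * e))%R
  | 3, 2, 1, 0 | 4, 3, 1, 0 => (- 2 * (1 - e))%R
  | 3, 1, 1, 1 => c%R
  | 4, 4, 0, 0 => 1%R
  | _, _, _, _ => 0%R
  end%N.

Lemma law_sym_value (S S' : comNzRingType) (j : {rmorphism S -> S'}) e c x y z l : (0 < l <= 4)%N ->
  (law (j e) (j c) x y z)`_l = sym_value (fun i k n => j (law_coef e c l i k n)) x y z.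
Proof.
have [_ c1 c2 c3 c4] := law_coefE (j e) (j c) x y z.
by case: l => [|[|[|[|[|]]]]] // _; rewrite ?(c1, c2, c3, c4) /sym_value /law_coef /=; ring.
Qed.

Definition candidate_coef (S : comNzRingType) (b d : S) (l i j k : nat) : S :=
  match l, i, j, k with
  | 1, 1, 0, 0 | 3, 3, 0, 0 => 4%R
  | 2, 1, 1, 0 | 4, 2, 1, 1 => (4 + b)%R
  | 2, 2, 0, 0 => 6%R
  | 3, 2, 1, 0 => (d - 4)%R
  | 3, 1, 1, 1 => (40 + 6 * b - 6 * d)%R
  | 4, 4, 0, 0 => 1%R
  | 4, 3, 1, 0 => (d - b - 4)%R
  | 4, 2, 2, 0 => (6 + 2 * b - 2 * d)%R
  | _, _, _, _ => 0%R
  end%N.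

Lemma candidate_sym_value (S S' : comNzRingType) (j : {rmorphism S -> S'}) b d x y z l :
    (0 < l <= 4)%N ->
  (candidate (j b) (j d) x y z)`_l
    = sym_value (fun i k n => j (candidate_coef b d l i k n)) x y z.
Proof.
case: l => [|[|[|[|[|]]]]] // _;
  rewrite /candidate ?(quartic1, quartic2, quartic3, quartic4);
  by rewrite /sym_value /candidate_coef /=; ring.
Qed.

(** * Consequences of the axioms at points *)

Section Uniqueness.
Variables (R : comAlgType Zeps) (F : {poly {mpoly R[3]}}).
Hypothesis FTL_F : is_FTL (map_poly mps_of_mpoly F).
Hypothesis degF : forall l m, (l < mdeg m)%N -> F`_l@_m = 0.
Local Notation eps := (eps R).

Lemma coef0F : F`_0 = 1.
Proof.
have [[F0 _] _ _ _ _ _] := FTL_F.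
by apply: mps_of_mpoly_inj; rewrite rmorph1 -F0 coef_map.
Qed.

Lemma sizeF : (size F <= 5)%N.
Proof.
have [[_ sF] _ _ _ _ _] := FTL_F; move: sF.
by rewrite size_map_inj_poly ?rmorph0 //; apply: mps_of_mpoly_inj.
Qed.

Lemma symF l : F`_l \is symmetric.
Proof.
apply/issymP => s; have [_ _ /ftl_symmetry_poly/(_ s) h _ _ _] := FTL_F.
by rewrite -[in RHS]h coef_map.
Qed.

Lemma msizeF l : (l <= 4)%N -> (msize F`_l <= 5)%N.
Proof.
move=> l4; rewrite msizeE; apply/bigmax_leqP_seq => m; rewrite mcoeff_msupp => nz _.
rewrite ltnS (leq_trans _ l4) // leqNgt; apply: contra nz => lt.
by rewrite degF.
Qed.

Lemma ev3_coef (S : comNzRingType) (h : {rmorphism R -> S}) x y z l : (l <= 4)%N ->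
  (ev3 h x y z F)`_l = sym_value (fun i j k => h F`_l@_(mnm3 [:: i; j; k])) x y z.
Proof. by move=> l4; rewrite coef_map /= mmap_symmetric ?symF ?msizeF. Qed.

Lemma ev3_eqP (S : comNzRingType) (h : {rmorphism R -> S}) x y z (P : {poly S}) :
    P`_0 = 1 -> (size P <= 5)%N ->
    (forall l, (0 < l <= 4)%N ->
      sym_value (fun i j k => h F`_l@_(mnm3 [:: i; j; k])) x y z = P`_l) ->
  ev3 h x y z F = P.
Proof.
move=> P0 sP PE; apply/polyP => l; have [l4|l4] := leqP l 4; last first.
  by rewrite coef_map /= !nth_default ?rmorph0 // ?(leq_trans sP) // (leq_trans sizeF).
case: l l4 => [_|l l4]; last by rewrite ev3_coef // PE.
by rewrite P0 coef_map /= coef0F rmorph1.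
Qed.

Lemma size_ev3 (S : comNzRingType) (h : {rmorphism R -> S}) x y z :
  (size (ev3 h x y z F) <= 5)%N.
Proof. exact: leq_trans (size_poly _ _) sizeF. Qed.

Lemma ev3_coef0 (S : comNzRingType) (h : {rmorphism R -> S}) x y z :
  (ev3 h x y z F)`_0 = 1.
Proof. by rewrite coef_map /= coef0F rmorph1. Qed.

Lemma ev3_swap (S : comNzRingType) (h : {rmorphism R -> S}) x y z :
  ev3 h x y z F = ev3 h y x z F.
Proof.
apply: ev3_eqP => [||l /andP[_ l4]]; rewrite ?size_ev3 ?ev3_coef0 // ev3_coef //.
exact: sym_valueC.
Qed.

Lemma ev3_swapr (S : comNzRingType) (h : {rmorphism R -> S}) x y z :
  ev3 h x y z F = ev3 h x z y F.
Proof.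
apply: ev3_eqP => [||l /andP[_ l4]]; rewrite ?size_ev3 ?ev3_coef0 // ev3_coef //.
exact: sym_valueAC.
Qed.

Lemma ev3_neutral (S : comNzRingType) (h : {rmorphism R -> S}) x :
  ev3 h x 0 0 F = law (h eps) 0 x 0 0.
Proof.
have e2 : h eps ^+ 2 = 1 by rewrite -rmorphXn eps_sqr rmorph1.
have [_ /ftl_neutral_poly + _ _ _ _] := FTL_F.
move=> /(congr1 (map_poly (mmap h (fun=> x)))); rewrite ev3_ev3 mmapX mmap1U rmorph0 => ->.
rewrite law_neutral // rmorphM !rmorphXn rmorphB rmorphD rmorph1 /= !map_polyZ !map_polyX.
by rewrite /= mmapZ mmapX mmap1U.
Qed.

Lemma ev3_linear (S : comNzRingType) (h : {rmorphism R -> S}) x y z :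
  ev3 h (- h eps * x) y z F = ev3 h x y z F \Po ((- h eps) *: 'X).
Proof.
have [_ _ _ _ /ftl_linearity_poly + _] := FTL_F.
move=> /(congr1 (map_poly (mmap h (vec3 x y z)))); rewrite ev3_ev3 map_comp_poly.
rewrite map_polyZ map_polyX /= mmapC raddfN mmapZ rmorphN !mmapX !mmap1U => ->.
by congr (_ \Po _); apply: eq_map_poly.
Qed.

Lemma ev3_weak (S : comNzRingType) (h : {rmorphism R -> S}) x : (ev3 h x x 0 F)`_4 = 0.
Proof.
have [_ _ _ _ _ /ftl_weak_neutral_poly] := FTL_F.
move=> /(congr1 (mmap h (fun=> x))); rewrite -coef_map ev3_ev3 mmapX mmap1U !rmorph0.
by [].
Qed.

Lemma composableF : composable (map_poly mps_of_mpoly F).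
Proof.
move=> l l0; rewrite coef_map /= /mps_of_mpoly; have [l4|l4] := leqP l 4; last first.
  by rewrite nth_default ?mcoeff0 // (leq_trans sizeF).
(* The neutral axiom at x = 0 reads F_t(0, 0, 0) = 1, so the constant terms vanish. *)
have := ev3_neutral [the {rmorphism R -> R} of idfun] 0.
rewrite law_neutral ?eps_sqr // mulr0 !scale0r addr0 subr0 !expr1n mulr1.
move=> /(congr1 (fun p : {poly R} => p`_l)); rewrite ev3_coef // coef1 (gtn_eqF l0).
have -> : 0%MM = mnm3 [:: 0; 0; 0]%N by apply/mnmP => -[[|[|[|]]]] // i; rewrite !mnmE.
by rewrite sym_value0.
Qed.

(** Associativity at (x, 0, z, 0, v): by the neutral axiom the values of F_t(0, z, 0) are z and -eps
    z, each twice. *)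
Lemma ev3_assoc (S : comNzRingType) (h : {rmorphism R -> S}) x z v (r : 'I_4 -> S) :
    ev3 h x 0 z F = \prod_(l < 4) (1 + r l *: 'X) ->
  \prod_(l < 4) ev3 h (r l) 0 v F
    = ev3 h x z v F ^+ 2 * ev3 h x (- h eps * z) v F ^+ 2.
Proof.
have e2 : h eps ^+ 2 = 1 by rewrite -rmorphXn eps_sqr rmorph1.
move=> rE; have [serF _ _ assocF _ _] := FTL_F.
have [H1 [H2 [H12 H1E H2E]]] := ftl_associativity_poly serF composableF.
have {}H12 := H12.1 assocF.
have := H1E S h x 0 z 0 v r rE; rewrite H12 => <-.
rewrite (H2E S h x 0 z 0 v (vec4 z z (- h eps * z) (- h eps * z))).
  by rewrite prod4 /vec4 !(tnth_nth 0) /= !expr2 mulrA.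
rewrite ev3_swap ev3_neutral law_neutral // prod4 /vec4 !(tnth_nth 0) /=.
by rewrite mulNr scaleNr !expr2 mulrA.
Qed.

(** * Determination of one rational component *)

Section Component.
Variable g : {rmorphism R -> rat}.
Local Notation a l i j k := (g F`_l@_(mnm3 [:: i; j; k]%N)).
Local Notation e := (g eps).

Lemma coefF_gt l i j k : (l < i + j + k)%N -> a l i j k = 0.
Proof.
move=> lt; rewrite degF ?rmorph0 //.
by rewrite mdegE !big_ord_recl big_ord0 !mnmE addn0 addnA.
Qed.

Lemma neutral_coef l x : (l <= 4)%N ->
  sym_value (fun i j k => a l i j k) x 0 0 = (law e 0 x 0 0)`_l.
Proof. by move=> l4; rewrite -ev3_neutral ev3_coef. Qed.

Lemma ev3_coef1 x y z : (ev3 g x y z F)`_1 = 2 * (1 - e) * (x + y + z).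
Proof.
rewrite ev3_coef //; apply: sym_value1 => [i j k|t]; first exact: coefF_gt.
by rewrite neutral_coef //; have [_ -> _ _ _] := law_coefE e 0 t 0 0; ring.
Qed.

Lemma ev3_coef2 : exists b, forall x y z, (ev3 g x y z F)`_2
  = 2 * (1 - 2 * e) * (x ^+ 2 + y ^+ 2 + z ^+ 2) + b * (x * y + y * z + x * z).
Proof.
have [i j k|t|b bE] := @sym_value2 (fun i j k => a 2 i j k) (2 * (1 - 2 * e)).
- exact: coefF_gt.
- by rewrite neutral_coef //; have [_ _ -> _ _] := law_coefE e 0 t 0 0; ring.
by exists b => x y z; rewrite ev3_coef.
Qed.

Lemma ev3_coef3 : exists d c f, forall x y z, (ev3 g x y z F)`_3
  = 2 * (1 - e) * (x ^+ 3 + y ^+ 3 + z ^+ 3)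
    + d * (x ^+ 2 * (y + z) + y ^+ 2 * (x + z) + z ^+ 2 * (x + y))
    + c * (x * y * z) + f * (x * y + y * z + x * z).
Proof.
have [i j k|t|d [c [f bE]]] := @sym_value3 (fun i j k => a 3 i j k) (2 * (1 - e)).
- exact: coefF_gt.
- by rewrite neutral_coef //; have [_ _ _ -> _] := law_coefE e 0 t 0 0; ring.
by exists d, c, f => x y z; rewrite ev3_coef.
Qed.

Lemma ev3_coef4 : exists k1 k2 k3 f1 f2 f3, forall x y z, (ev3 g x y z F)`_4
  = x ^+ 4 + y ^+ 4 + z ^+ 4
    + k1 * (x ^+ 3 * (y + z) + y ^+ 3 * (x + z) + z ^+ 3 * (x + y))
    + k2 * (x ^+ 2 * y ^+ 2 + y ^+ 2 * z ^+ 2 + x ^+ 2 * z ^+ 2)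
    + k3 * (x ^+ 2 * y * z + y ^+ 2 * x * z + z ^+ 2 * x * y)
    + f1 * (x * y + y * z + x * z)
    + f2 * (x ^+ 2 * (y + z) + y ^+ 2 * (x + z) + z ^+ 2 * (x + y))
    + f3 * (x * y * z).
Proof.
have [t|k1 [k2 [k3 [f1 [f2 [f3 E]]]]]] := @sym_value4 (fun i j k => a 4 i j k).
  by rewrite neutral_coef //; have [_ _ _ _ ->] := law_coefE e 0 t 0 0; ring.
by exists k1, k2, k3, f1, f2, f3 => x y z; rewrite ev3_coef.
Qed.

(** Coefficients are found by rational linear algebra and then carried to [algC], where laws split,
    or to polynomial rings, where variables are generic. *)
Lemma ev3_transfer (B : nat -> nat -> nat -> nat -> rat) :
    (forall x y z l, (0 < l <= 4)%N -> (ev3 g x y z F)`_l = sym_value (B l) x y z) ->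
  forall (S : comNzRingType) (j : {rmorphism rat -> S}) x y z l, (0 < l <= 4)%N ->
    (ev3 (j \o g) x y z F)`_l = sym_value (fun i k n => j (B l i k n)) x y z.
Proof.
move=> FB S j x y z l l4; have /andP[_ l4'] := l4; rewrite ev3_coef //=.
apply: (@sym_value_transfer (fun i k n => a l i k n) (B l)) => x' y' z'.
by rewrite -FB // ev3_coef.
Qed.

Lemma size_quartic (S : comNzRingType) (c1 c2 c3 c4 : S) : (size (quartic c1 c2 c3 c4) <= 5)%N.
Proof.
apply/leq_sizeP => i; case: i => [|[|[|[|[|i]]]]] // _.
by rewrite /quartic !(coefD, coefZ, coef1, coefX, coefXn) /= !(mulr0, addr0).
Qed.

Lemma component_pos : e = 1 ->
  exists2 c, c = 8 \/ c = - 8 & forall (S : comNzRingType) (j : {rmorphism rat -> S}) x y z,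
    ev3 (j \o g) x y z F = law (j e) (j c) x y z.
Proof.
move=> e1; have E1 := ev3_coef1; have [b E2] := ev3_coef2; have [d [c [f E3]]] := ev3_coef3.
have [k1 [k2 [k3 [f1 [f2 [f3 E4]]]]]] := ev3_coef4.
rewrite e1 in E1 E2 E3.
(* For eps = 1, F_l has the parity of l in x, and by symmetry in each variable; the points below
   eliminate the terms of wrong parity. *)
have L l x y z : (ev3 g (- x) y z F)`_l = (ev3 g x y z F)`_l * (- 1) ^+ l.
  by rewrite -coef_comp_scaleX -[in X in _ \Po X]e1 -ev3_linear e1 mulN1r.
have W x : (ev3 g x x 0 F)`_4 = 0 := ev3_weak g x.
have b0 : b = 0 by move: (L 2%N 1 1 0); rewrite !E2; lra.
have [d0 f0] : d = 0 /\ f = 0.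
  by move: (L 3%N 1 1 0) (L 3%N 0 1 1); rewrite !E3 => *; split; lra.
(* Once parity removes the other mixed terms, F_4(1, 1, 0) = 2 + k2, which vanishes by the weak
   neutral axiom. *)
have k20 : k2 = - 2.
  move: (W 1) (L 4%N 1 1 0) (L 4%N 1 (-1) 0) (L 4%N 1 2 0).
  by rewrite !E4 => *; lra.
have [k10 f10 f20] : [/\ k1 = 0, f1 = 0 & f2 = 0].
  move: (L 4%N 1 1 0) (L 4%N 1 (-1) 0) (L 4%N 1 2 0).
  by rewrite !E4 => *; split; lra.
have [k30 f30] : k3 = 0 /\ f3 = 0.
  by move: (L 4%N 1 1 1) (L 4%N 1 1 2); rewrite !E4 => *; split; lra.
have T : forall (S : comNzRingType) (j : {rmorphism rat -> S}) x y z,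
    ev3 (j \o g) x y z F = law (j e) (j c) x y z.
  move=> S j x y z; have coefE := @ev3_transfer (law_coef e c) _ S j x y z.
  apply: ev3_eqP => [||l l4]; rewrite ?size_law //; first by have [] := law_coefE (j e) (j c) x y z.
  rewrite law_sym_value // -coefE // => [|{l l4}x' y' z' l l4]; last first.
    rewrite -(@law_sym_value _ _ idfun) //=; have [_ c1 c2 c3 c4] := law_coefE e c x' y' z'.
    case: l l4 => [|[|[|[|[|]]]]] // _; rewrite ?(c1, c2, c3, c4) ?(E1, E2, E3, E4) e1.
    - by ring.
    - by rewrite b0; ring.
    - by rewrite d0 f0; ring.
    - by rewrite k10 k20 k30 f10 f20 f30; ring.
  by rewrite ev3_coef //; case/andP: l4.
exists c => //.
have T' x y z : ev3 g x y z F = law 1 c x y z by rewrite -e1; apply: (T _ idfun).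
(* The values of F_t(1, 0, 1) = 1 - 4 t^2 are 2, -2, 0, 0. *)
have := @ev3_assoc _ g 1 1 1 (vec4 2 (- 2) 0 0).
rewrite !T' prod4 prod4 /vec4 !(tnth_nth 0) /= => assoc.
have : law 1 c 1 0 1 = (1 + 2 *: 'X) * (1 + (- 2) *: 'X) * (1 + 0 *: 'X) * (1 + 0 *: 'X).
  by rewrite /law -!mul_polyC; ring.
(* At t = 1 the left side vanishes, since F_1(2, 0, 1) = 0, and the right side is (c - 8)^2 (c +
   8)^2. *)
move=> /assoc; rewrite e1 => /(congr1 (horner^~ 1)).
rewrite !(hornerM, horner_exp, T') !law1_horner1 => h.
have /eqP : (c - 8) * (c + 8) = 0.
  apply/eqP; rewrite -sqrf_eq0; apply/eqP; lra.
by rewrite mulf_eq0 subr_eq0 addr_eq0 => /orP[/eqP|/eqP]; [left|right].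
Qed.

Definition ratr_algC : {rmorphism rat -> algC} := ratr.

Lemma ev3_ratr x y z :
  ev3 (ratr_algC \o g) (ratr x) (ratr y) (ratr z) F = map_poly ratr (ev3 g x y z F).
Proof.
apply/esym/map_poly_comp_rmorph => [|p]; first exact: rmorph0.
by rewrite /= rmorph_mmap; apply: eq_mmap => // i /=; rewrite map_vec3.
Qed.

(* One of the four values of x * x is 0 by the weak neutral axiom, so that
   v is one of the values of x * x * v, with F_t(x, x, v) vanishing at -1/v. *)
Lemma ev3_root x v : e = - 1 -> v != 0 -> root (ev3 g x x v F) (- v^-1).
Proof.
move=> eN1 v0; pose h : {rmorphism R -> algC} := ratr_algC \o g.
have he : h eps = - 1 by rewrite /h /= eN1 rmorphN1.
have [r rE] := split_quartic (ev3_coef0 h (ratr x) 0 (ratr x)) (size_ev3 _ _ _ _).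
have prod0 : r 0 * r 1 * r 2 * r 3 = 0.
  have := ev3_weak h (ratr x); rewrite ev3_swapr rE prod4.
  have -> : (1 + r 0 *: 'X) * (1 + r 1 *: 'X) * (1 + r 2 *: 'X) * (1 + r 3 *: 'X)
    = quartic (r 0 + r 1 + r 2 + r 3)
        (r 0 * r 1 + r 0 * r 2 + r 0 * r 3 + r 1 * r 2 + r 1 * r 3 + r 2 * r 3)
        (r 0 * r 1 * r 2 + r 0 * r 1 * r 3 + r 0 * r 2 * r 3 + r 1 * r 2 * r 3)
        (r 0 * r 1 * r 2 * r 3) by rewrite /quartic -!mul_polyC; ring.
  by rewrite quartic4.
have [l rl0] : exists l, r l = 0.
  move/eqP: prod0; rewrite !mulf_eq0 => /orP[/orP[/orP[]|]|] /eqP rl0;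
    by [exists 0|exists 1|exists 2|exists 3].
have := ev3_assoc (ratr v) rE; rewrite he opprK mul1r -exprD.
move=> /(congr1 (horner^~ (ratr (- v^-1)))); rewrite horner_prod horner_exp (bigD1 l) //= rl0.
have -> : (ev3 h 0 0 (ratr v) F).[ratr (- v^-1)] = 0.
  rewrite ev3_swapr ev3_swap ev3_neutral law_neutral ?he ?sqrrN ?expr1n // hornerM horner_exp.
  rewrite hornerD hornerC hornerZ hornerX -rmorphM mulrN divff // rmorphN1 subrr.
  by rewrite expr0n mul0r.
rewrite mul0r => /esym/eqP; rewrite expf_eq0 /= ev3_ratr horner_map fmorph_eq0.
by rewrite rootE.
Qed.

Lemma candidate_unique b d (r0 : forall x z v : algC,
    exists r : 'I_4 -> algC, candidate (ratr b) (ratr d) x 0 z = \prod_(l < 4) (1 + r l *: 'X) /\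
    \prod_(l < 4) candidate (ratr b) (ratr d) (r l) 0 v = candidate (ratr b) (ratr d) x z v ^+ 4) :
  b = 0 /\ d = 0 :> rat.
Proof.
(* The second relation has the form 4 v (v q1 + 2 q2) = 0; taking v = 1 and v = 2 separates q1 from
   q2. *)
have [r [/candidate_newton h /h [e1 e2]]] := r0 1 1 1.
have [r' [/candidate_newton h' /h' [_ e3]]] := r0 1 1 2.
have inj (q : rat) : ratr q = 0 :> algC -> q = 0 by move/eqP; rewrite fmorph_eq0 => /eqP.
have {}e1 : 6 * 1 * (4 * b ^+ 2 - b * d - 56 * b + 24 * d) = 0.
  by apply: inj; rewrite -[RHS]e1; ring.
have {}e2 : 4 * 1 * (1 * (- b ^+ 3 + 68 * b ^+ 2 - 20 * b * d - 688 * b + 304 * d)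
       + 2 * (104 * b ^+ 2 - 63 * b * d - 704 * b + 9 * d ^+ 2 + 328 * d)) = 0.
  by apply: inj; rewrite -[RHS]e2; ring.
have {}e3 : 4 * 2 * (2 * (- b ^+ 3 + 68 * b ^+ 2 - 20 * b * d - 688 * b + 304 * d)
       + 2 * (104 * b ^+ 2 - 63 * b * d - 704 * b + 9 * d ^+ 2 + 328 * d)) = 0.
  by apply: inj; rewrite -[RHS]e3; ring.
clear - e1 e2 e3.
have q0 : 4 * b ^+ 2 - b * d - 56 * b + 24 * d = 0 by lra.
have q1 : - b ^+ 3 + 68 * b ^+ 2 - 20 * b * d - 688 * b + 304 * d = 0 by lra.
have q2 : 104 * b ^+ 2 - 63 * b * d - 704 * b + 9 * d ^+ 2 + 328 * d = 0 by lra.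
(* [b] and [d] are linear combinations of q0, q1, q2 and the multiples below, with the monomials in
   [b] and [d] taken as independent unknowns. *)
have m q t : q = 0 -> q * t = 0 :> rat by move=> ->; rewrite mul0r.
have := (m _ b q0, m _ d q0, m _ (b * d) q0, m _ (b ^+ 2) q0, m _ (d ^+ 2) q0).
have := (m _ b q1, m _ d q1, m _ b q2, m _ d q2, m _ (b * d) q2).
move=> [[[[a1 a2] a3] a4] a5] [[[[a6 a7] a8] a9] a10].
by split; lra.
Qed.

Lemma component_neg : e = - 1 -> forall (S : comNzRingType) (j : {rmorphism rat -> S}) x y z,
  ev3 (j \o g) x y z F = law (- 1) 40 x y z.
Proof.
move=> eN1; have E1 := ev3_coef1; have [b E2] := ev3_coef2; have [d [c [f E3]]] := ev3_coef3.
have [k1 [k2 [k3 [f1 [f2 [f3 E4]]]]]] := ev3_coef4.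
rewrite eN1 in E1 E2 E3.
have W x : (ev3 g x x 0 F)`_4 = 0 := ev3_weak g x.
have horner4 (p : {poly rat}) t : p`_0 = 1 -> (size p <= 5)%N ->
    p.[t] = 1 + p`_1 * t + p`_2 * t ^+ 2 + p`_3 * t ^+ 3 + p`_4 * t ^+ 4.
  move=> p0 sp; rewrite (horner_coef_wide _ sp) !big_ord_recl big_ord0 /= p0.
  by rewrite /bump /= expr0 expr1 mulr1 addr0 !addrA.
(* The root -1/v of F_t(x, x, v), written as a relation linear in the unknown coefficients. *)
have V x v : v != 0 -> 1 + (ev3 g x x v F)`_1 * (- v^-1) + (ev3 g x x v F)`_2 * (- v^-1) ^+ 2
    + (ev3 g x x v F)`_3 * (- v^-1) ^+ 3 + (ev3 g x x v F)`_4 * (- v^-1) ^+ 4 = 0.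
  by move=> v0; rewrite -horner4 ?ev3_coef0 ?size_ev3 //; apply/rootP/ev3_root.
have V1 x := V x 1 isT; have VN1 x := V x (- 1) isT.
(* F_4(x, x, 0) has only terms in x^4, x^3 and x^2, which three values of x separate. *)
have [f10 f20 k20] : [/\ f1 = 0, f2 = 0 & k2 = - 2 - 2 * k1].
  by move: (W 1) (W (- 1)) (W 2); rewrite !E4 => *; split; lra.
have [f0 f30 k1E k3E cE] : [/\ f = 0, f3 = 0, k1 = d - b + 4, k3 = b & c = 6 * b - 6 * d - 8].
  move: (V1 1) (V1 (- 1)) (V1 2) (VN1 1) (VN1 (- 1)) (VN1 2).
  rewrite !(E1, E2, E3, E4) f10 f20 k20 invr1 invrN1 opprK !expr1n.
  by clear => *; split; lra.
(* The additive law has coefficient 4 at xy t^2 and -4 at x^2y t^3; [candidate] takes the deviations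
   from these, hence b - 4 and d + 4. *)
have T (S : comNzRingType) (j : {rmorphism rat -> S}) x y z :
    ev3 (j \o g) x y z F = candidate (j (b - 4)) (j (d + 4)) x y z.
  have coefE := @ev3_transfer (candidate_coef (b - 4) (d + 4)) _ S j x y z.
  apply: ev3_eqP => [||l l4]; rewrite ?quartic0 ?size_quartic //.
  rewrite candidate_sym_value // -coefE // => [|{l l4}x' y' z' l l4]; last first.
    rewrite -(@candidate_sym_value _ _ idfun) //= /candidate.
    case: l l4 => [|[|[|[|[|]]]]] // _.
    - by rewrite E1 quartic1; ring.
    - by rewrite E2 quartic2; ring.
    - by rewrite E3 quartic3 f0 cE; ring.
    - by rewrite E4 quartic4 f10 f20 f30 k3E k20 k1E; ring.
  by rewrite ev3_coef //; case/andP: l4.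
have [b4 d4] : b - 4 = 0 /\ d + 4 = 0.
  apply: candidate_unique => x z v.
  have [r rE] := split_quartic (ev3_coef0 (ratr_algC \o g) x 0 z) (size_ev3 _ _ _ _).
  exists r; split; first by rewrite -rE T.
  have := ev3_assoc v rE; rewrite /= eN1 rmorphN1 opprK mul1r -exprD T => <-.
  by apply: eq_bigr => l _; rewrite T.
move=> S j x y z; rewrite T b4 d4 rmorph0 /candidate /quartic /law.
by congr (_ + _ *: _ + _ *: _ + _ *: _ + _ *: _); ring.
Qed.

End Component.

End Uniqueness.

(** * Classification over Z_eps[1/2] *)

Lemma chow_witt_law_mpoly (R : comAlgType Zeps) :
  chow_witt_FTL R = map_poly mps_of_mpoly (law_mpoly (8 * (2 - 3 * eps R))).
Proof.
by rewrite chow_witt_law map_law /= !mps_of_mpolyC !mps_of_mpolyX.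
Qed.


(** F_l has only monomials of degree at most l, and l is at most 4, so truncation below degree 5
    loses nothing. *)
Lemma degree_le0_poly (R : comAlgType Zeps) (F : {poly mps R 3}) :
    is_series 4 F -> degree_le F 0 ->
  exists2 P : {poly {mpoly R[3]}}, F = map_poly mps_of_mpoly P
    & forall l m, (l < mdeg m)%N -> P`_l@_m = 0.
Proof.
move=> [F0 sF] dF.
have F_eq0 l m : (l < mdeg m)%N -> (F`_l : mps R 3) m = 0.
  move=> lm; have [l5|l5] := leqP 5 l; first by rewrite nth_default // (leq_trans sF).
  case: l lm l5 => [|l] lm l5.
    (* [degree_le] does not concern l = 0; there F_0 = 1 has no monomial of positive degree. *)
    rewrite F0 -[LHS]/((m == 0%MM)%:R : R); case: eqP => // m0.
    by move: lm; rewrite m0 mdeg0.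
  apply/eqP; apply: contraLR lm => /(dF _ _ _) h; have := h l5.
  by rewrite Order.TotalTheory.leNgt subr_gt0 ltz_nat -leqNgt.
pose P : {poly {mpoly R[3]}} := \poly_(l < 5) mps_trunc 5 F`_l.
have PE l m : P`_l@_m = (F`_l : mps R 3) m.
  rewrite coef_poly; case: ltnP => l5; last by rewrite mcoeff0 nth_default // (leq_trans sF).
  have [m5|m5] := ltnP (mdeg m) 5; first by rewrite mcoeff_trunc.
  rewrite F_eq0 ?(leq_trans l5) //; apply/eqP; apply: contraTT m5.
  rewrite -mcoeff_msupp -ltnNge => /msize_mdeg_lt /leq_trans; apply.
  rewrite /mps_trunc (leq_trans (msize_sum _ _ _)) //.
  by apply/bigmax_leqP_seq => k _ _; rewrite (leq_trans (msizeZ_le _ _)) // mmeasureX bmdeg.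
exists P; last by move=> l m lm; rewrite PE F_eq0.
by apply/polyP => l; rewrite coef_map; apply: mpsP => m; rewrite /= /mps_of_mpoly PE.
Qed.

Theorem theorem1 (R : comAlgType Zeps)
    (R_loc : is_localization_away (2 : Zeps) R) :
  exists2 G : {poly mps R 3},
    G <> chow_witt_FTL R
    & forall F : {poly mps R 3},
        (is_FTL F /\ degree_le F 0) <-> (F = chow_witt_FTL R \/ F = G).
Proof.
have [f [f_inj f_eps]] := localization_embedding R_loc.
(* Exchanging 2 and 3 changes the sign at eps = 1, from -8 to 8, and keeps the value 40 at eps =
   -1. *)
pose c1 : R := 8 * (2 - 3 * eps R); pose c2 : R := 8 * (3 - 2 * eps R).
have fc1 : f c1 = (8 * - 1, 40).
  by rewrite /c1 rmorphM rmorphB rmorphM /= f_eps !rmorph_nat; apply/eqP; vm_compute.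
have fc2 : f c2 = (8 * 1, 40).
  by rewrite /c2 rmorphM rmorphB rmorphM /= f_eps !rmorph_nat; apply/eqP; vm_compute.
pose fst' : {rmorphism (rat * rat)%type -> rat} := fst.
pose snd' : {rmorphism (rat * rat)%type -> rat} := snd.
have ftl c s : s = 1 \/ s = - 1 -> f c = (8 * s, 40) ->
    is_FTL (map_poly mps_of_mpoly (law_mpoly c))
    /\ degree_le (map_poly mps_of_mpoly (law_mpoly c)) 0.
  move=> s1 fc; split; last exact: degree_law.
  exact/is_FTL_law/(law_associativity f_inj f_eps s1 fc).
exists (map_poly mps_of_mpoly (law_mpoly c2)) => [|F]; rewrite chow_witt_law_mpoly -/c1.
  (* The two laws differ in the t^3 coefficient at (1, 1, 1) on the component eps = 1. *)
  move=> /(@iota_inj R 3) /(congr1 (ev3 (fst' \o f) 1 1 1)).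
  rewrite !ev3_law => /(congr1 (fun p : {poly rat} => p`_3)).
  have [_ _ _ -> _] := law_coefE ((fst' \o f) (eps R)) ((fst' \o f) c2) 1 1 1.
  have [_ _ _ -> _] := law_coefE ((fst' \o f) (eps R)) ((fst' \o f) c1) 1 1 1.
  by rewrite /= fc1 fc2 => /addrI; vm_compute.
split=> [[FTL_F degF]|[->|->]]; last 2 first.
- by apply: ftl fc1; right.
- by apply: ftl fc2; left.
have [P FE degP] := degree_le0_poly (FTL_series FTL_F) degF; rewrite {}FE in FTL_F *.
have e1 : (fst' \o f) (eps R) = 1 by rewrite /= f_eps.
have eN1 : (snd' \o f) (eps R) = - 1 by rewrite /= f_eps.
have [c cE TP] := component_pos FTL_F degP e1.
have TN := component_neg FTL_F degP eN1.
(* Evaluating at the variables of Q[x_0, x_1, x_2] on each component recovers every coefficient, and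
   the embedding is injective. *)
have PE c' : f c' = (c, 40) -> P = law_mpoly c'.
  move=> fc'; apply/polyP => l; apply/mpolyP => m.
  pose x i : {mpoly rat[3]} := 'X_i.
  have X3 k : vec3 (x 0) (x 1) (x 2) k = 'X_k.
    by case: k => [[|[|[|]]]] // p; congr ('X__); apply: val_inj.
  have evE (j : {rmorphism R -> rat}) (Q : {poly {mpoly R[3]}}) :
      (ev3 (@mpolyC 3 rat \o j) (x 0) (x 1) (x 2) Q)`_l@_m = j Q`_l@_m.
    by rewrite coef_map /= (eq_mmap (fun=> erefl) X3) -/(map_mpoly j _) mcoeff_map_mpoly.
  apply: (eq_from_pair f_inj).
    rewrite -[LHS]/((fst' \o f) _) -[RHS]/((fst' \o f) _) -!evE.
    by rewrite (TP _ (@mpolyC 3 rat)) ev3_law /= fc'.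
  rewrite -[LHS]/((snd' \o f) _) -[RHS]/((snd' \o f) _) -!evE.
  rewrite (TN _ (@mpolyC 3 rat)) ev3_law /= fc' f_eps /= mpolyCN mpolyC1.
  by rewrite (rmorph_nat (@mpolyC 3 rat)).
by case: cE => cE; [right|left]; congr map_poly; apply: PE; rewrite (fc1, fc2) cE ?mulrN1 ?mulr1.
Qed.
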